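(* Assume $E X_1<\infty$, the distribution of $X_1$ is non-lattice and $X_1>0$ a.s., $E V_1^q<\infty$ for every $q>0$, and the CDF $F$ of $V_1$ is continuous. Assume $\rho:=E V_1/E X_1<1$ and the number of servers of the $s$-th loss system is $C_s=s$. Then for every $\delta>0$, $$E_\pi^s|\tau|=o(s^{\delta})\quad\text{as } s\to\infty.$$
   Context: Let $(X_n)_{n\ge1}$ be i.i.d. strictly positive interarrival times with mean $\mu\in(0,\infty)$ and $(V_n)_{n\ge1}$ i.i.d. nonnegative service times with CDF $F$, independent of $(X_n)$. For $s\in\{1,2,\dots\}$ the $s$-th system is the time-stationary GI/GI/$\infty$ queue on $\mathbb R$ whose arrivals form a time-stationary renewal process with interarrival times distributed as $X_1/s$, each customer receiving a service time distributed as $V_1$ (not scaled), beginning service immediately upon arrival. For $t\in\mathbb R$, $y\ge0$, let $Q(t,y)$ be the number of customers present at time $t$ whose residual service time is strictly greater than $y$ (a customer arriving at $t$ is counted at $t$, one departing at $t$ is not), and let $R(t)$ be the maximum residual service time among customers present at time $t$ ($R(t)=0$ if none). Given a number of servers $C_s$, define the coalescence-detection time $$\tau=\sup\{t<0:\ R(t)<|t| \ \text{and}\ Q(u,0)\le C_s \text{ for all } u\in[t,t+R(t)]\}.$$ $E_\pi^s$ denotes expectation for the stationary $s$-th system. *)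

(* Defs.v *)
From HB Require Import structures.
From mathcomp Require Import all_boot all_order all_algebra.
From mathcomp Require Import all_classical all_reals all_analysis.
Set Implicit Arguments. Unset Strict Implicit. Unset Printing Implicit Defensive.
Import Order.TTheory GRing.Theory Num.Theory.
Import numFieldNormedType.Exports.
Local Open Scope classical_set_scope.
Local Open Scope ring_scope.

Section Defs.
Context {d : measure_display} {Omega : measurableType d} {R : realType}.
Variable P : probability Omega R.

Definition same_law (Y Z : Omega -> R) : Prop :=
  forall B : set R, measurable B -> P (Y @^-1` B) = P (Z @^-1` B).

Definition CDF (Y : Omega -> R) (x : R) : R := fine (P [set w | Y w <= x]).

Definition non_lattice (Y : Omega -> R) : Prop :=
  ~ exists dd : R, 0 < dd /\ P [set w | exists k : int, Y w = k%:~R * dd] = 1%E.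

Definition uniform01 (U : Omega -> R) : Prop :=
  forall B : set R, measurable B ->
    P (U @^-1` B) = (@lebesgue_measure R) (B `&` `[0, 1]).

Definition length_biased (L Y : Omega -> R) : Prop :=
  forall B : set R, measurable B ->
    (P (L @^-1` B) * 'E_P[Y] =
     \int[P]_(w in [set w | B (Y w)]) (Y w)%:E)%E.

(** Arrival times of the time-stationary renewal process on R built from the
    length [L] of the interarrival interval straddling 0, the uniform position
    [U] of 0 inside it, the forward interarrival times [Fw] (after T_1) and the
    backward ones [Bw] (before T_0). Customers are indexed by int, with
    T_0 <= 0 < T_1. *)
Fixpoint fwd_time (L U : R) (Fw : nat -> R) (k : nat) : R :=
  match k with
  | 0 => (1 - U) * L
  | k'.+1 => fwd_time L U Fw k' + Fw k'
  end.

Fixpoint bwd_time (L U : R) (Bw : nat -> R) (k : nat) : R :=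
  match k with
  | 0 => - (U * L)
  | k'.+1 => bwd_time L U Bw k' - Bw k'
  end.

Definition arr_time (L U : R) (Fw Bw : nat -> R) (n : int) : R :=
  match n with
  | Posz 0 => bwd_time L U Bw 0
  | Posz k.+1 => fwd_time L U Fw k
  | Negz k => bwd_time L U Bw k.+1
  end.

(** The s-th stationary GI/GI/infinity system: all primitive variables are
    measurable and mutually independent (product formula for every finite
    subfamily, sets may be [setT]), with the prescribed laws. *)
Definition stationary_system (X1 V1 : Omega -> R) (s : nat)
  (L U : Omega -> R) (Fw Bw : nat -> Omega -> R) (Sv : int -> Omega -> R) : Prop :=
  [/\ (measurable_fun setT L /\ measurable_fun setT U /\
       (forall k, measurable_fun setT (Fw k)) /\ (forall k, measurable_fun setT (Bw k)) /\
       (forall n, measurable_fun setT (Sv n))),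
      (length_biased L (fun w => X1 w / s%:R) /\ uniform01 U /\
       (forall k, same_law (Fw k) (fun w => X1 w / s%:R)) /\
       (forall k, same_law (Bw k) (fun w => X1 w / s%:R)) /\
       (forall n, same_law (Sv n) V1)) &
      forall (m : nat) (BL BU : set R) (BF BB : nat -> set R) (BS : int -> set R),
        measurable BL -> measurable BU -> (forall k, measurable (BF k)) ->
        (forall k, measurable (BB k)) -> (forall n, measurable (BS n)) ->
        P (L @^-1` BL `&` U @^-1` BU
           `&` \bigcap_(k in `I_m) (Fw k @^-1` BF k)
           `&` \bigcap_(k in `I_m) (Bw k @^-1` BB k)
           `&` \bigcap_(k in `I_m) (Sv (Posz k) @^-1` BS (Posz k))
           `&` \bigcap_(k in `I_m) (Sv (Negz k) @^-1` BS (Negz k)))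
        = (P (L @^-1` BL) * P (U @^-1` BU)
           * \prod_(k < m) P (Fw k @^-1` BF k)
           * \prod_(k < m) P (Bw k @^-1` BB k)
           * \prod_(k < m) P (Sv (Posz k) @^-1` BS (Posz k))
           * \prod_(k < m) P (Sv (Negz k) @^-1` BS (Negz k)))%E].

End Defs.

Section Queue.
Context {R : realType}.
Variables (T S : int -> R).
(** T n = arrival time, S n = service time of customer n. *)

Definition Qset (t y : R) : set int := [set n | T n <= t /\ y < T n + S n - t].

Definition card_le (A : set int) (c : nat) : Prop :=
  exists l : seq int, (size l <= c)%N /\ A `<=` [set` l].

(** Maximal residual service time at t (0 if nobody is present). *)
Definition Rmax (t : R) : \bar R :=
  Order.max 0%E (ereal_sup [set (T n + S n - t)%:E | n in Qset t 0]).

(** Coalescence-detection time with C servers (-oo if the set is empty). *)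
Definition tau (C : nat) : \bar R :=
  ereal_sup [set t%:E | t in [set t : R | t < 0 /\ (Rmax t < (- t)%:E)%E /\
     forall u, t <= u <= t + fine (Rmax t) -> card_le (Qset u 0) C]].

End Queue.

(* Main.v *)
Require Import Defs.
From HB Require Import structures.
From mathcomp Require Import all_boot all_order all_algebra.
From mathcomp Require Import finmap.
From mathcomp Require Import all_classical all_reals all_analysis.
From mathcomp Require Import measurable_realfun.
From mathcomp Require Import ring lra zify.
Set Implicit Arguments. Unset Strict Implicit. Unset Printing Implicit Defensive.
Import Order.TTheory GRing.Theory Num.Theory.
Import numFieldNormedType.Exports.
Local Open Scope classical_set_scope.
Local Open Scope ring_scope.

(* Customers are indexed backwards in time: customer [-n] has interarrival time
   [Bw n] to its successor. For a window [N, N + h] of indices, the arrival time of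
   customer [-(N + h)] is admissible in the definition of [tau] as soon as (i) every
   customer [-n] with [n >= N + h] is gone when [-N] arrives, and (ii) at each arrival
   [-k] of the window at most [s] customers are present. Both conditions compare a
   service time with the interval between two arrivals, so they fail only if a service
   time is atypically long (polynomially rare, all moments being finite), a sum of
   interarrival times is atypically small (exponentially rare, by a Laplace transform
   bound that needs no upper moment), or too many services are long (Chernoff bound;
   this is where [rho < 1] enters).

   Take disjoint windows with indices growing like [h 2^j], [h = s b], [b ~ s^(delta/2)].
   If the windows [k, ..., 2k] all fail, then either all of them fail because of their
   own customers, which has probability at most [8^-(k+1)] by independence, or one of
   them fails because of an older customer, which has probability [O(8^-k)]. Either
   bound beats the [O(4^k)] length of the indices involved. The length itself is a sum
   of interarrival times with only a first moment; it stays under control because the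
   failure bounds are sums of products of functions of single variables in which
   interarrival times enter only through factors [exp(- kappa x) <= 1], so that
   replacing one factor by [x] costs at most [E x / alpha].

   The interval straddling 0 may have infinite mean. But [tau = 0] unless some customer
   arrived before 0 has a service exceeding that interval, which bounds the age of
   the interval at 0 by the largest excess service. *)

(** * Integration and independence *)

Section integration.
Context {d : measure_display} {Omega : measurableType d} {R : realType}.
Variable P : probability Omega R.
Local Open Scope ereal_scope.
Import HBNNSimple.

(* [f] need not be measurable: its integral is a supremum over simple functions. *)
Lemma integral_le_ae_majorant (f g : Omega -> \bar R) :
  (forall w, 0 <= f w) -> (forall w, 0 <= g w) -> measurable_fun setT g ->
  {ae P, forall w, f w <= g w} -> \int[P]_w f w <= \int[P]_w g w.
Proof.
move=> f0 g0 mg fg; rewrite ge0_integralTE//.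
apply: ge_ereal_sup => _ [h /= hf <-].
have -> : sintegral P h = \int[P]_w (h w)%:E.
  by rewrite integral_nnsfun// patch_setT.
apply: ae_ge0_le_integral => //.
- by move=> x _; rewrite lee_fin.
- exact/measurable_EFinP.
- by apply: filterS fg => w fgw _; exact: le_trans (hf w) fgw.
Qed.

(** The hypothesis is the case of indicators; both sides are additive in [f], so it passes to simple
    functions and then, by monotone convergence, to every nonnegative [f]. *)
Lemma integral_mul_comp_le (G Y : Omega -> R) (c : R) :
  measurable_fun setT G -> (forall w, 0 <= G w)%R ->
  measurable_fun setT Y -> (0 <= c)%R ->
  (forall B : set R, measurable B ->
    \int[P]_w (G w * \1_B (Y w))%:E <= c%:E * P (Y @^-1` B)) ->
  forall f : R -> R, measurable_fun setT f -> (forall x, 0 <= f x)%R ->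
  \int[P]_w (G w * f (Y w))%:E <= c%:E * \int[P]_w (f (Y w))%:E.
Proof.
move=> mG G0 mY c0 H.
have ind0 (h : {nnsfun R >-> R}) (y x : R) : (0 <= y * \1_(h @^-1` [set y]) x)%R.
  rewrite indicE; case: (boolP (x \in _)); last by rewrite mulr0.
  by rewrite inE/= mulr1 => <-.
have mI (h : {nnsfun R >-> R}) (y : R) :
    measurable_fun setT (fun w => (\1_(h @^-1` [set y]) (Y w) : R)).
  by apply: measurableT_comp => //; exact: measurable_indic.
have simple (h : {nnsfun R >-> R}) :
    \int[P]_w (G w * h (Y w))%:E <= c%:E * \int[P]_w (h (Y w))%:E.
  have E (F : Omega -> R) : (forall w, 0 <= F w)%R -> measurable_fun setT F ->
      \int[P]_w (F w * h (Y w))%:E =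
      \sum_(y <- fset_set (range h))
        \int[P]_w (y * (F w * \1_(h @^-1` [set y]) (Y w)))%:E.
    move=> F0 mF; rewrite -ge0_integral_sum//.
    - apply: eq_integral => w _; rewrite fimfunE fsbig_finite//= mulr_sumr sumEFin.
      by congr EFin; apply: eq_bigr => i _; rewrite mulrCA.
    - move=> y; apply/measurable_EFinP; apply: measurable_funM => //.
      exact: measurable_funM.
    - by move=> y w _; rewrite lee_fin mulrCA mulr_ge0.
  rewrite (E G)//.
  under eq_integral do rewrite -[h _]mul1r.
  rewrite (E (cst 1%R))// ge0_sume_distrr; last first.
    by move=> y _; apply: integral_ge0 => w _; rewrite lee_fin mulrCA mulr_ge0.
  apply: lee_sum => y _.
  (* [h] takes no negative value, so for [y < 0] the level set is empty and both integrals
     vanish. *)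
  have [y0|y0] := leP 0%R y; last first.
    rewrite !integral0_eq ?mule0//= => w _;
    by have := ind0 h y (Y w); rewrite indicE; case: (_ \in _);
      rewrite ?mulr0 ?mulr1 ?mul1r// leNgt y0.
  under eq_integral do rewrite EFinM.
  rewrite ge0_integralZl//; last 2 first.
    by apply/measurable_EFinP; apply: measurable_funM.
    by move=> w _; rewrite lee_fin mulr_ge0.
  under [in leRHS]eq_integral do rewrite mul1r EFinM.
  rewrite [in leRHS]ge0_integralZl//; last exact/measurable_EFinP.
  rewrite muleCA; apply: lee_pmul => //.
    by apply: integral_ge0 => w _; rewrite lee_fin mulr_ge0.
  have mh : measurable (h @^-1` [set y]) by exact: measurable_sfunP.
  have -> : \int[P]_w (\1_(h @^-1` [set y]) (Y w))%:E = P (Y @^-1` (h @^-1` [set y])).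
    have mhY : measurable (Y @^-1` (h @^-1` [set y])).
      by rewrite -[X in measurable X]setTI; exact: mY.
    by rewrite -[in RHS](setIT (Y @^-1` _)) -integral_indic.
  exact: H.
move=> f mf f0.
have mf' : measurable_fun setT (EFin \o f) by exact/measurable_EFinP.
pose h := nnsfun_approx measurableT mf'.
have hf n x : (h n x <= f x)%R.
  by rewrite -lee_fin /h nnsfun_approxE; apply: le_approx => // t _; rewrite lee_fin.
have hcvg x : (h n x)%:E @[n --> \oo] --> (f x)%:E.
  by apply: cvg_nnsfun_approx => // t _; rewrite lee_fin.
have mh n : measurable_fun setT (fun w => h n (Y w)) by apply: measurableT_comp.
have -> : \int[P]_w (G w * f (Y w))%:E =
    limn (fun n => \int[P]_w (G w * h n (Y w))%:E).
  rewrite -monotone_convergence//.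
  - apply: eq_integral => w _; apply/esym/cvg_lim => //=.
    under eq_fun do rewrite EFinM.
    by rewrite EFinM; apply: cvgeZl.
  - by move=> n; apply/measurable_EFinP; exact: measurable_funM.
  - by move=> n w _; rewrite lee_fin mulr_ge0.
  - move=> w _ m n mn; rewrite lee_fin ler_wpM2l//.
    by have /lefP := nd_nnsfun_approx measurableT mf' mn; exact.
apply: lime_le.
  apply: ereal_nondecreasing_is_cvgn => m n mn; apply: ge0_le_integral => //=.
  - by move=> w _; rewrite lee_fin mulr_ge0.
  - by apply/measurable_EFinP; exact: measurable_funM.
  - by apply/measurable_EFinP; exact: measurable_funM.
  - move=> w _; rewrite lee_fin ler_wpM2l//.
    by have /lefP := nd_nnsfun_approx measurableT mf' mn; exact.
apply: nearW => n; apply: le_trans (simple _) _.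
apply: lee_wpmul2l; first by rewrite lee_fin.
apply: ge0_le_integral => //=.
- by move=> w _; rewrite lee_fin.
- exact/measurable_EFinP.
- by apply/measurable_EFinP; apply: measurableT_comp.
- by move=> w _; rewrite lee_fin.
Qed.

Lemma integral_same_law (Y Z : Omega -> R) (f : R -> R) :
  measurable_fun setT Y -> measurable_fun setT Z -> same_law P Y Z ->
  measurable_fun setT f -> (forall x, 0 <= f x)%R ->
  \int[P]_w (f (Y w))%:E = \int[P]_w (f (Z w))%:E.
Proof.
move=> mY mZ YZ mf f0.
have mf' : measurable_fun setT (EFin \o f) by exact/measurable_EFinP.
have fge : {in setT, forall y, 0 <= (EFin \o f) y} by move=> y _; rewrite lee_fin.
rewrite -[LHS](ge0_integral_pushforward mY P measurableT mf' fge).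
rewrite -[RHS](ge0_integral_pushforward mZ P measurableT mf' fge).
by apply: eq_measure_integral => A mA _; exact: YZ.
Qed.

(** The indicators of the product formula are exchanged for the [f i] one coordinate at a time; each
    exchange is [integral_mul_comp_le], with [G] the product of the other factors. *)
Lemma integral_prod_indep_le (n : nat) (Y : nat -> Omega -> R) :
  (forall i, (i < n)%N -> measurable_fun setT (Y i)) ->
  (forall B : nat -> set R, (forall i, measurable (B i)) ->
    P (\bigcap_(i in `I_n) (Y i @^-1` B i)) = \prod_(i < n) P (Y i @^-1` B i)) ->
  forall (f : nat -> R -> R) (a : nat -> R),
  (forall i, measurable_fun setT (f i)) -> (forall i x, 0 <= f i x)%R ->
  (forall i, (i < n)%N -> \int[P]_w (f i (Y i w))%:E <= (a i)%:E) ->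
  \int[P]_w (\prod_(i < n) f i (Y i w))%:E <= (\prod_(i < n) a i)%:E.
Proof.
move=> mY ind f a mf f0 fa.
have a0 i : (i < n)%N -> (0 <= a i)%R.
  move=> ilt; rewrite -lee_fin; apply: le_trans (fa i ilt).
  by apply: integral_ge0 => w _; rewrite lee_fin.
have mfY i : (i < n)%N -> measurable_fun setT (fun w => f i (Y i w)).
  by move=> ilt; apply: measurableT_comp => //; exact: mY.
pose F (j : nat) (B : nat -> set R) i :=
  if (i < j)%N then f i else (\1_(B i) : R -> R).
pose c (j : nat) (B : nat -> set R) i :=
  if (i < j)%N then a i else fine (P (Y i @^-1` B i)).
(* In this hybrid product the first [j] factors are functions and the others still indicators of
   arbitrary sets; the freedom in [B] carries the induction. *)
have key (j : nat) : (j <= n)%N -> forall B : nat -> set R, (forall i, measurable (B i)) ->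
    \int[P]_w (\prod_(i < n) F j B i (Y i w))%:E <= (\prod_(i < n) c j B i)%:E.
  elim: j => [_|j IH jn] B mB.
    have -> : (fun w => (\prod_(i < n) F 0%N B i (Y i w))%:E) =
        fun w => (\1_(\bigcap_(i in `I_n) (Y i @^-1` B i)) w)%:E.
      apply/funext => w; congr EFin; rewrite indicE.
      case: (boolP (w \in _)) => [|wB]; [rewrite inE => wB|].
        rewrite big1// => i _; rewrite /F ltn0 indicE mem_set//.
        exact: (wB _ (ltn_ord i)).
      have [i iB] : exists i : 'I_n, ~ (Y i @^-1` B i) w.
        apply: contrapT => /forallNP H; move: wB; rewrite notin_setE; apply.
        by move=> i /= ilt; have /contrapT := H (Ordinal ilt).
      rewrite (bigD1 i)//= /F ltn0 indicE memNset//= mul0r//.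
    rewrite integral_indic//; last first.
      apply: fin_bigcap_measurable => [|i ilt]; first exact: finite_II.
      by rewrite -[X in measurable X]setTI; apply: mY.
    rewrite setIT le_eqVlt; apply/orP; left; apply/eqP.
    apply: etrans (ind B mB) _; rewrite -prodEFin.
    apply: eq_bigr => i _; rewrite /c ltn0 fineK// fin_num_measure//.
    by rewrite -[X in measurable X]setTI; apply: mY.
  pose G w := (\prod_(i < n | i != Ordinal jn) F j B i (Y i w))%R.
  pose C := (\prod_(i < n | i != Ordinal jn) c j B i)%R.
  have mF k i : (i < n)%N -> measurable_fun setT (fun w => F k B i (Y i w)).
    move=> ilt; rewrite /F; case: (ltnP i k) => _; first exact: mfY.
    by apply: measurableT_comp; [exact: measurable_indic|exact: mY].
  have F0 k i x : (0 <= F k B i x)%R.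
    by rewrite /F; case: ifP.
  have -> : (\prod_(i < n) c j.+1 B i = C * a j)%R.
    rewrite (bigD1 (Ordinal jn))//= {1}/c ltnSn mulrC; congr (_ * _)%R.
    apply: eq_bigr => i ij; rewrite /c ltnS leq_eqVlt.
    by case: eqVneq => //= E; move: ij; rewrite -val_eqE /= E eqxx.
  have -> : (fun w => (\prod_(i < n) F j.+1 B i (Y i w))%:E) =
      (fun w => (G w * f j (Y j w))%:E).
    apply/funext => w; congr EFin.
    rewrite (bigD1 (Ordinal jn))//= {1}/F ltnSn mulrC; congr (_ * _)%R.
    apply: eq_bigr => i ij; rewrite /F ltnS leq_eqVlt.
    by case: eqVneq => //= E; move: ij; rewrite -val_eqE /= E eqxx.
  have C0 : (0 <= C)%R.
    apply: prodr_ge0 => i _; rewrite /c; case: ifP => _; first exact: a0.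
    exact: fine_ge0.
  have G0 w : (0 <= G w)%R by apply: prodr_ge0 => i _; exact: F0.
  have mG : measurable_fun setT G.
    have -> : G = fun w => (\prod_(i < n)
        if i != Ordinal jn then F j B i (Y i w) else 1)%R.
      by apply/funext => w; rewrite /G big_mkcond.
    by apply: measurable_prod => i _; case: (i != _) => //; exact: mF.
  apply: (@le_trans _ _ (C%:E * \int[P]_w (f j (Y j w))%:E)); last first.
    by rewrite EFinM; apply: lee_wpmul2l; rewrite ?lee_fin// fa.
  apply: integral_mul_comp_le => //; first exact: mY.
  move=> D mD.
  (* With [D] in position [j], the induction hypothesis is the indicator case required by
     [integral_mul_comp_le]. *)
  pose B' i := if i == j then D else B i.
  have mB' i : measurable (B' i) by rewrite /B'; case: ifP.
  have := IH (ltnW jn) B' mB'.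
  congr (_ <= _).
    apply: eq_integral => w _; congr EFin.
    rewrite (bigD1 (Ordinal jn))//= {1}/F ltnn /B' eqxx mulrC; congr (_ * _)%R.
    apply: eq_bigr => i ij; rewrite /F.
    by case: ifP => // _; case: eqVneq => // E; move: ij; rewrite -val_eqE /= E eqxx.
  rewrite (bigD1 (Ordinal jn))//= {1}/c ltnn /B' eqxx mulrC EFinM; congr (_ * _).
    congr EFin; apply: eq_bigr => i ij; rewrite /c.
    by case: ifP => // _; case: eqVneq => // E; move: ij; rewrite -val_eqE /= E eqxx.
  by rewrite fineK// fin_num_measure// -[X in measurable X]setTI; apply: mY.
have := key n (leqnn _) (fun=> setT) (fun=> measurableT).
congr (_ <= _); [apply: eq_integral => w _; congr EFin|congr EFin];
  by apply: eq_bigr => i _; rewrite /F /c ltn_ord.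
Qed.

End integration.

(** * Sample paths *)

Section backward_queue.
Context {R : realType}.

(** The integer [- k], written by the cases of [arr_time] so that arrival times of past customers
    compute to [bwd_time]. *)
Definition back_index (k : nat) : int := if k is k'.+1 then Negz k' else Posz 0.

Variables (L U : R) (F B : nat -> R) (S : int -> R) (C : nat).
Hypothesis UL_ge0 : 0 <= U * L.
Hypothesis UL1_ge0 : 0 <= (1 - U) * L.
Hypothesis F_ge0 : forall k, 0 <= F k.
Hypothesis B_gt0 : forall k, 0 < B k.

Let T := arr_time L U F B.
Let A := bwd_time L U B.
Let v k := S (back_index k).
Let W k n := \sum_(k <= i < n) B i.

Let AE k : A k = - (U * L) - W 0 k.
Proof.
rewrite /A /W; elim: k => [|k IH] /=; first by rewrite big_geq// subr0.
by rewrite IH big_nat_recr//= opprD addrA.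
Qed.

Let AW k n : (k <= n)%N -> A k - A n = W k n.
Proof.
move=> kn; rewrite !AE /W (big_cat_nat (leq0n k) kn)/=; ring.
Qed.

Let W_ge0 k n : 0 <= W k n.
Proof. by apply: sumr_ge0 => i _; exact: ltW. Qed.

Let W_mono k m n : (k <= m)%N -> W m n <= W k n.
Proof.
move=> km; have [mn|nm] := leqP m n; last by rewrite [leLHS]big_geq ?W_ge0// ltnW.
by rewrite /W (big_cat_nat km mn)/= lerDr; exact: W_ge0.
Qed.

Let A_anti k n : (k < n)%N -> A n < A k.
Proof.
move=> kn; rewrite -subr_gt0 AW 1?ltnW// /W big_ltn//.
by rewrite ltr_pwDl//; exact: W_ge0.
Qed.

Let fwd_ge0 k : 0 <= fwd_time L U F k.
Proof. by elim: k => //= k IH; rewrite addr_ge0. Qed.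

Let Qset_back (t : R) (n : int) : t < 0 -> Qset T S t 0 n ->
  exists k, [/\ n = back_index k, A k <= t & t < A k + v k].
Proof.
move=> t0 [Tn]; rewrite subr_gt0 => tn.
case: n Tn tn => [[|k]|k] /= Tn tn.
- by exists 0%N; split.
- by have := le_lt_trans Tn t0; rewrite ltNge fwd_ge0.
- by exists k.+1; split.
Qed.

Let tau_le (t : R) : t < 0 -> (Rmax T S t < (- t)%:E)%E ->
  (forall u, t <= u <= t + fine (Rmax T S t) -> Defs.card_le (Qset T S u 0) C) ->
  (`| tau T S C | <= (- t)%:E)%E.
Proof.
move=> t0 h1 h2.
have tau0 : (tau T S C <= 0)%E.
  by apply: ge_ereal_sup => _ [r [r0 _] <-]; rewrite lee_fin ltW.
rewrite lee0_abs// EFinN leeN2.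
by apply: ereal_sup_ubound; exists t.
Qed.

(** The candidate is the arrival time [A c]. Whoever is present then has backward index at least
    [c], hence has left by [A N < 0]; so the maximal residual service is at most
    [A N - A c < - A c], and the occupancy matters only up to [A N]. *)
Lemma tau_le_candidate (N c : nat) : (0 < N <= c)%N ->
  (forall n, (c <= n)%N -> v n <= W N n) ->
  (forall k, (N <= k <= c)%N -> exists2 l : seq nat, (size l <= C)%N &
     forall n, (k <= n)%N -> W k n < v n -> n \in l) ->
  (`| tau T S C | <= (U * L + W 0 c)%:E)%E.
Proof.
move=> /andP[N0 Nc] h1 h2.
have -> : U * L + W 0 c = - A c by rewrite AE opprD !opprK.
have A0 : A 0%N <= 0 by rewrite /A /= oppr_le0.
have Ac0 : A c < 0.
  exact: lt_le_trans (A_anti (leq_trans N0 Nc)) A0.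
have AN0 : A N < 0 by exact: lt_le_trans (A_anti N0) A0.
have Rm : (Rmax T S (A c) <= (W N c)%:E)%E.
  rewrite /Rmax ge_max lee_fin W_ge0/=.
  apply: ge_ereal_sup => _ [n /(Qset_back Ac0) [k [-> Ak kA]] <-].
  have ck : (c <= k)%N.
    by rewrite leqNgt; apply/negP => /A_anti; rewrite ltNge Ak.
  have -> : T (back_index k) = A k by rewrite /T /A; case: (k).
  have Wk : W N k = A N - A k by rewrite AW// (leq_trans Nc).
  rewrite lee_fin -AW//.
  by have := h1 _ ck; rewrite Wk /v; lra.
have Rm0 : (0 <= Rmax T S (A c))%E by rewrite /Rmax le_max lexx.
have Rfin : Rmax T S (A c) \is a fin_num.
  by rewrite ge0_fin_numE// (le_lt_trans Rm)// ltry.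
apply: tau_le => //.
  apply: le_lt_trans Rm _; rewrite lte_fin -AW//; lra.
move=> u /andP[Au uR].
have {uR} uN : u <= A N.
  apply: le_trans uR _; rewrite -lerBrDl AW// -lee_fin fineK//.
have u0 : u < 0 by exact: le_lt_trans AN0.
(* The least such [k] is the latest arrival not after [u]. No one enters between [A k] and [u], so
   whoever is present at [u] is counted by the second hypothesis at [k]. *)
have exk : exists k, A k <= u by exists c.
pose k := ex_minn exk.
have [kP kmin] : A k <= u /\ (forall m, A m <= u -> (k <= m)%N).
  by rewrite /k; case: ex_minnP.
have kc : (k <= c)%N by exact: kmin.
have Nk : (N <= k)%N.
  rewrite leqNgt; apply/negP => /A_anti kN.
  by have := lt_le_trans kN kP; rewrite ltNge uN.
have [l ls hl] : exists2 l : seq nat, (size l <= C)%N &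
     forall n, (k <= n)%N -> W k n < v n -> n \in l by apply: h2; rewrite Nk.
exists (map back_index l); split; first by rewrite size_map.
move=> n /(Qset_back u0) [m [-> Am mA]] /=.
apply: map_f; apply: hl; first exact: kmin.
by rewrite -AW ?kmin//; lra.
Qed.

(** By hypothesis every past customer has left by time [g - U * L < 0]. The system is then empty up
    to time 0, every [t] in between is admissible, and such [t] come arbitrarily close to 0. *)
Lemma tau_eq0 (g : R) : (forall n, v n <= W 0 n + g) -> 0 <= g < U * L ->
  tau T S C = 0%E.
Proof.
move=> hv /andP[g0 gUL].
have bnd (e : R) : 0 < e -> (`| tau T S C | <= e%:E)%E.
  move=> e0; pose t := - Num.min e (U * L - g).
  have t0 : t < 0 by rewrite oppr_lt0 lt_min e0 subr_gt0.
  have tg : g - U * L <= t by rewrite lerNr opprB ge_min lexx orbT.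
  have te : - t <= e by rewrite opprK ge_min lexx.
  have Q0 u : t <= u -> u < 0 -> Qset T S u 0 = set0.
    move=> tu u0; rewrite -subset0 => n /(Qset_back u0) [k [_ _]].
    by have := hv k; rewrite AE; lra.
  have R0 : Rmax T S t = 0%E.
    by rewrite /Rmax (Q0 t)// image_set0 ereal_sup0 maxeNy.
  apply: (@le_trans _ _ (- t)%:E); last by rewrite lee_fin.
  apply: tau_le; rewrite ?R0 ?lte_fin ?oppr_gt0//= addr0 => u.
  by rewrite -eq_le => /eqP <-; exists [::]; split=> //; rewrite Q0.
apply/eqP; rewrite -abse_eq0 eq_le abse_ge0 andbT.
by apply/lee_addgt0Pr => e e0; rewrite add0e; exact: bnd.
Qed.

(** Trades [U * L], whose mean may be infinite, for [g]: either [U * L <= g], or [tau] vanishes. *)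
Lemma tau_le_excess (g : R) (N c : nat) : 0 <= g ->
  (forall n, v n <= W 0 n + g) -> (0 < N <= c)%N ->
  (forall n, (c <= n)%N -> v n <= W N n) ->
  (forall k, (N <= k <= c)%N -> exists2 l : seq nat, (size l <= C)%N &
     forall n, (k <= n)%N -> W k n < v n -> n \in l) ->
  (`| tau T S C | <= (g + W 0 c)%:E)%E.
Proof.
move=> g0 hv Nc h1 h2; have [gUL|ULg] := ltP g (U * L).
  by rewrite (tau_eq0 hv) ?g0// abse0 lee_fin addr_ge0.
apply: le_trans (tau_le_candidate Nc h1 h2) _.
by rewrite lee_fin lerD2r.
Qed.

End backward_queue.

(** * Path functionals that dominate the failure events *)

Section path_functionals.
Context {R : realType}.
Variables (y : nat -> R) (kappa eta : R) (B v : nat -> R).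

(* Customer [-n] would survive for the nominal duration [y] of [n - k] interarrival
   times; [fast] exponentially penalizes [n - k] interarrival times that are jointly
   shorter than nominal. Outside both events customer [-n] is gone when [-k] arrives. *)
Definition late (k n : nat) : R := (y (n - k)%N < v n)%R%:R.

Definition fast (k n : nat) : R :=
  expR (kappa * (y (n - k)%N - \sum_(k <= l < n) B l)).

(** A Chernoff weight, at least 1 once [K] of the customers with [n >= k + i0] are late. The [i0]
    youngest customers are all counted as present, so [K] will be [C - i0]. *)
Definition crowd (K : R) (i0 M k : nat) : R :=
  expR (eta * (\sum_(k + i0 <= n < M) late k n - K)).

(** A sum of penalties, each at least 1 on its own failure event, so that a value below 1 excludes
    all these events at once. Only primitives of index in [[N, M)] enter; older customers belong to
    [remote_failure]. *)
Definition window_failure (K : R) (i0 h N M : nat) : R :=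
  \sum_(N + h <= n < M) late N n +
  \sum_(N <= k < (N + h).+1) (\sum_(k + i0 <= n < M) fast k n + crowd K i0 M k).

(** At least 1 whenever customer [-n] is still present when [-c] arrives (see [survival_lt1]). *)
Definition survival (c n : nat) : R := late c n + fast c n.

Hypothesis kappa_ge0 : 0 <= kappa.
Hypothesis eta_gt0 : 0 < eta.
Hypothesis B_ge0 : forall k, 0 <= B k.

Let W k n := \sum_(k <= i < n) B i.

Let W_mono k m n : (k <= m)%N -> W m n <= W k n.
Proof.
move=> km; have [mn|nm] := leqP m n; last first.
  by rewrite [leLHS]big_geq 1?ltnW//; apply: sumr_ge0 => i _.
by rewrite /W (big_cat_nat km mn)/= lerDr; apply: sumr_ge0 => i _.
Qed.

Lemma late_ge0 k n : 0 <= late k n. Proof. exact: ler0n. Qed.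
Lemma fast_ge0 k n : 0 <= fast k n. Proof. exact: expR_ge0. Qed.
Lemma survival_ge0 k n : 0 <= survival k n.
Proof. by rewrite addr_ge0 ?late_ge0 ?fast_ge0. Qed.

Let late_lt1 k n : late k n < 1 -> v n <= y (n - k)%N.
Proof. by rewrite /late; case: (ltP (y _) (v n)) => //; rewrite ltxx. Qed.

Let fast_lt1 k n : fast k n < 1 -> y (n - k)%N <= W k n.
Proof.
rewrite /fast -expR0 ltr_expR => H; rewrite leNgt; apply/negP => WY.
by move: H; rewrite ltNge mulr_ge0// subr_ge0 ltW.
Qed.

Lemma survival_lt1 k n : survival k n < 1 -> v n <= W k n.
Proof.
move=> H; apply: (@le_trans _ _ (y (n - k)%N)).
  by apply: late_lt1; apply: le_lt_trans H; rewrite lerDl fast_ge0.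
by apply: fast_lt1; apply: le_lt_trans H; rewrite lerDr late_ge0.
Qed.

Let le_term (F : nat -> R) a b n : (forall i, 0 <= F i) -> (a <= n < b)%N ->
  F n <= \sum_(a <= i < b) F i.
Proof.
move=> F0 nab; rewrite (bigD1_seq n) ?mem_index_iota ?iota_uniq//=.
by rewrite lerDl sumr_ge0.
Qed.

Lemma window_failure_ge0 K i0 h N M : 0 <= window_failure K i0 h N M.
Proof.
apply: addr_ge0; apply: sumr_ge0 => k _; first exact: late_ge0.
by rewrite addr_ge0 ?expR_ge0// sumr_ge0// => n _; exact: fast_ge0.
Qed.

(** All terms are nonnegative, so each is below 1 and no single failure event occurs. Customers from
    [M] on are gone when [-(N + h)] arrives, a fortiori when a later [-k] does. *)
Lemma window_failure_lt1 (C i0 h N M : nat) : (i0 <= h)%N -> (i0 <= C)%N ->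
  (N + h <= M)%N ->
  window_failure (C - i0)%:R i0 h N M < 1 ->
  (forall n, (M <= n)%N -> survival (N + h) n < 1) ->
  (forall n, (N + h <= n)%N -> v n <= W N n) /\
  (forall k, (N <= k <= N + h)%N -> exists2 l : seq nat, (size l <= C)%N &
     forall n, (k <= n)%N -> W k n < v n -> n \in l).
Proof.
move=> i0h i0C NhM Phi Psi.
have fast0 k : 0 <= \sum_(k + i0 <= n < M) fast k n.
  by apply: sumr_ge0 => i _; exact: fast_ge0.
have far k n : (k <= N + h)%N -> (M <= n)%N -> v n <= W k n.
  by move=> kc Mn; apply: le_trans (survival_lt1 (Psi _ Mn)) (W_mono _ kc).
have term k : (N <= k <= N + h)%N ->
    \sum_(k + i0 <= n < M) fast k n + crowd (C - i0)%:R i0 M k < 1.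
  move=> kN; apply: le_lt_trans Phi.
  apply: (@le_trans _ _ (\sum_(N <= k < (N + h).+1)
      (\sum_(k + i0 <= n < M) fast k n + crowd (C - i0)%:R i0 M k))); last first.
    by rewrite lerDr sumr_ge0// => n _; exact: late_ge0.
  apply: (le_term (F := fun k =>
     \sum_(k + i0 <= n < M) fast k n + crowd (C - i0)%:R i0 M k)); last by rewrite ltnS.
  by move=> i; rewrite addr_ge0 ?expR_ge0.
have near k n : (N <= k <= N + h)%N -> (k + i0 <= n < M)%N -> y (n - k)%N <= W k n.
  move=> kN nM; apply: fast_lt1; apply: le_lt_trans (term k kN).
  apply: (@le_trans _ _ (\sum_(k + i0 <= n < M) fast k n)).
    by apply: (le_term (F := fast k)) => // i; exact: fast_ge0.
  by rewrite lerDl expR_ge0.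
split=> [n cn|k kN].
  have [nM|Mn] := ltnP n M; last by apply: far => //; rewrite leq_addr.
  apply: (@le_trans _ _ (y (n - N)%N)).
    apply: late_lt1; apply: le_lt_trans Phi.
    apply: (@le_trans _ _ (\sum_(N + h <= n < M) late N n)).
      by apply: (le_term (F := late N)) => [i|]; [exact: late_ge0|rewrite cn].
    by rewrite lerDl sumr_ge0// => i _; rewrite addr_ge0 ?expR_ge0.
  apply: near; first by rewrite leqnn leq_addr.
  by rewrite nM (leq_trans _ cn)// leq_add2l.
(* The [i0] youngest customers are listed whatever their service, the older ones only if late;
   [crowd < 1] keeps the number of the latter below [C - i0]. *)
exists (iota k i0 ++ [seq n <- index_iota (k + i0) M | y (n - k)%N < v n]).
  rewrite size_cat size_iota size_filter.
  have : crowd (C - i0)%:R i0 M k < 1.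
    by apply: le_lt_trans (term k kN); rewrite lerDr.
  rewrite /crowd expR_lt1 pmulr_rlt0// subr_lt0.
  have -> : \sum_(k + i0 <= n < M) late k n =
      (count (fun n => y (n - k)%N < v n) (index_iota (k + i0) M))%:R.
    rewrite -sum1_count natr_sum [RHS]big_mkcond/=.
    by apply: eq_bigr => n _; rewrite /late; case: ifP.
  by rewrite ltr_nat; lia.
move=> n kn Wv; rewrite mem_cat mem_iota kn/=.
have [//|kin] := ltnP n (k + i0); rewrite mem_filter mem_index_iota kin/=.
have [nM|Mn] := ltnP n M; last first.
  by move: Wv; rewrite ltNge far//; have /andP[] := kN.
by rewrite andbT (le_lt_trans _ Wv)// near// kin.
Qed.

(** These terms reach arbitrarily far back, which couples the windows; they are therefore kept apart
    and only summed, never multiplied. *)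
Definition remote_failure (h N M : nat) : \bar R :=
  (\sum_(0 <= n <oo) (survival (N + h) (M + n))%:E)%E.

(** The price of the joint failure of the windows [k, ..., 2k]. If a window [j] of the next group
    [k + 1, ..., 2k + 2] succeeds, its candidate has index at most [T (j + 1)], hence at most
    [T (2k + 3)]. *)
Definition stage_cost (T : nat -> nat) (K : R) (i0 h k : nat) : \bar R :=
  ((W 0 (T (2 * k).+3))%:E *
   ((\prod_(k <= j < (2 * k).+1) window_failure K i0 h (T j) (T j.+1))%:E +
    \sum_(k <= j < (2 * k).+1) remote_failure h (T j) (T j.+1)))%E.

Lemma remote_failure_ge0 h N M : (0 <= remote_failure h N M)%E.
Proof. by apply: nneseries_ge0 => n _ _; rewrite lee_fin survival_ge0. Qed.

Lemma stage_cost_ge0 T K i0 h k : (0 <= stage_cost T K i0 h k)%E.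
Proof.
rewrite mule_ge0//; first by rewrite lee_fin sumr_ge0.
rewrite adde_ge0// ?lee_fin ?prodr_ge0// => [j _|]; first exact: window_failure_ge0.
by apply: sume_ge0 => j _; exact: remote_failure_ge0.
Qed.

(** A majorant of all [v n - W 0 n]. Only services beyond the cutoff [b] enter the series, which
    keeps its mean small. *)
Definition excess (b : R) : \bar R :=
  (b%:E + \sum_(0 <= n <oo) (`|v n| * (b < v n)%R%:R * survival 0 n)%:E)%E.

Lemma excess_ge0 b : 0 <= b -> (0 <= excess b)%E.
Proof.
move=> b0; rewrite adde_ge0 ?lee_fin//; apply: nneseries_ge0 => n _ _.
by rewrite lee_fin !mulr_ge0// survival_ge0.
Qed.

(** A service above [b] is either at most [W 0 n], or has [survival 0 n >= 1], and then its own term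
    of the series dominates it. *)
Lemma le_excess b n : 0 <= b -> ((v n)%:E <= (W 0 n)%:E + excess b)%E.
Proof.
move=> b0; have W0 : (0 <= (W 0 n)%:E)%E by rewrite lee_fin sumr_ge0.
have S0 i : (0 <= (`|v i| * (b < v i)%R%:R * survival 0 i)%:E)%E.
  by rewrite lee_fin !mulr_ge0// survival_ge0.
have [vb|bv] := leP (v n) b.
  apply: (@le_trans _ _ (excess b)); last by rewrite leeDr.
  apply: (@le_trans _ _ b%:E); first by rewrite lee_fin.
  by rewrite leeDl// nneseries_ge0.
have [lt1|ge1] := ltP (survival 0 n) 1.
  apply: (@le_trans _ _ (W 0 n)%:E); first by rewrite lee_fin survival_lt1.
  by rewrite leeDl// excess_ge0.
apply: (@le_trans _ _ (excess b)); last by rewrite leeDr.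
apply: (@le_trans _ _ (\sum_(0 <= n <oo) (`|v n| * (b < v n)%R%:R * survival 0 n)%:E)%E);
  last by rewrite leeDr// lee_fin.
apply: le_trans (nneseries_lim_ge n.+1 _) => //.
rewrite big_nat_recr//= -[leLHS]add0e leeD ?sume_ge0// lee_fin bv mulr1.
by rewrite (le_trans (ler_norm _))// ler_peMr.
Qed.

Let window_good (C N c : nat) :=
  (forall n, (c <= n)%N -> v n <= W N n) /\
  (forall k, (N <= k <= c)%N -> exists2 l : seq nat, (size l <= C)%N &
     forall n, (k <= n)%N -> W k n < v n -> n \in l).

(** If some remote penalty of the group reaches 1, so does their sum. Otherwise [window_failure_lt1]
    forces every window penalty to be at least 1, hence their product. *)
Lemma stage_cost_bad T (C i0 h k : nat) : (i0 <= h)%N -> (i0 <= C)%N ->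
  (forall j, (T j + h <= T j.+1)%N) ->
  (forall j, (k <= j <= 2 * k)%N -> ~ window_good C (T j) (T j + h)) ->
  ((W 0 (T (2 * k).+3))%:E <= stage_cost T (C - i0)%:R i0 h k)%E.
Proof.
move=> i0h i0C Th bad; rewrite /stage_cost lee_pemulr//.
  by rewrite lee_fin sumr_ge0.
have wf0 j := window_failure_ge0 (C - i0)%:R i0 h (T j) (T j.+1).
have [[j jk Rj]|noR] := pselect (exists2 j, (k <= j < (2 * k).+1)%N &
    (1 <= remote_failure h (T j) (T j.+1))%E).
  apply: le_trans Rj _.
  apply: (@le_trans _ _ (\sum_(k <= j < (2 * k).+1) remote_failure h (T j) (T j.+1))%E).
    rewrite (bigD1_seq j) ?mem_index_iota ?iota_uniq//= leeDl// sume_ge0// => i _.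
    exact: remote_failure_ge0.
  by rewrite leeDr// lee_fin prodr_ge0.
apply: (@le_trans _ _ (\prod_(k <= j < (2 * k).+1)
    window_failure (C - i0)%:R i0 h (T j) (T j.+1))%:E); last first.
  by rewrite leeDl// sume_ge0// => i _; exact: remote_failure_ge0.
rewrite lee_fin big_nat_cond; apply: (big_ind (fun z => 1 <= z)) => // [? ? ? ?|j].
  exact: mulr_ege1.
rewrite andbT => kj.
rewrite leNgt; apply/negP => Phi.
apply: (bad j) => //; apply: window_failure_lt1 Phi _ => // n Mn.
rewrite ltNge; apply/negP => S1; apply: noR; exists j => //.
rewrite /remote_failure.
apply: le_trans (nneseries_lim_ge (n - T j.+1).+1 _) => [|i _]; last first.
  by rewrite lee_fin survival_ge0.
rewrite big_nat_recr//= subnKC//.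
apply: (@le_trans _ _ (survival (T j + h) n)%:E); first by rewrite lee_fin.
by rewrite leeDr// sume_ge0// => i _; rewrite lee_fin survival_ge0.
Qed.

End path_functionals.

(** Take the least [k] whose group [k, ..., 2k] contains a good window. For [k = 0] the candidate
    lies within the first [T 1] indices; otherwise the whole previous group fails, and its stage
    cost covers the distance to the candidate. *)
Lemma tau_le_stages {R : realType} (L U : R) (F B : nat -> R) (S : int -> R) (C : nat)
  (y : nat -> R) (kappa eta g : R) (T : nat -> nat) (i0 h : nat) :
  let v := fun k => S (back_index k) in
  0 <= U * L -> 0 <= (1 - U) * L -> (forall k, 0 <= F k) -> (forall k, 0 < B k) ->
  0 <= kappa -> 0 < eta -> 0 <= g ->
  (i0 <= h)%N -> (i0 <= C)%N -> (0 < T 0)%N -> (forall j, (T j + h <= T j.+1)%N) ->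
  (forall n, v n <= \sum_(0 <= i < n) B i + g) ->
  (`| tau (arr_time L U F B) S C | <= g%:E + (\sum_(0 <= i < T 1) B i)%:E +
    \sum_(0 <= k <oo) stage_cost y kappa eta B v T (C - i0)%:R i0 h k)%E.
Proof.
move=> v UL UL1 F0 B0 k0 e0 g0 i0h i0C T0 Th vg.
have B0' k : 0 <= B k by exact: ltW.
pose W k n := \sum_(k <= i < n) B i.
have W_mono a b : (a <= b)%N -> W 0 a <= W 0 b.
  by move=> ab; rewrite /W (big_cat_nat (leq0n a) ab)/= lerDl sumr_ge0.
have T_mono a b : (a <= b)%N -> (T a <= T b)%N.
  move=> ab; apply: (@homo_leq _ T leq) => // [? ? ?|i]; first exact: leq_trans.
  by apply: leq_trans (Th i); exact: leq_addr.
pose sc k := stage_cost y kappa eta B v T (C - i0)%:R i0 h k.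
have sc0 k : (0 <= sc k)%E by exact: stage_cost_ge0.
have ge_sc k : (sc k <= \sum_(0 <= k <oo) sc k)%E.
  apply: le_trans (nneseries_lim_ge k.+1 _) => //.
  by rewrite big_nat_recr//= leeDr// sume_ge0.
pose good j := (forall n, (T j + h <= n)%N -> v n <= W (T j) n) /\
  (forall k, (T j <= k <= T j + h)%N -> exists2 l : seq nat, (size l <= C)%N &
     forall n, (k <= n)%N -> W k n < v n -> n \in l).
have tau_good j : good j -> (`| tau (arr_time L U F B) S C | <= (g + W 0 (T j.+1))%:E)%E.
  move=> [h1 h2].
  have Tj : (0 < T j <= T j + h)%N by rewrite leq_addr (leq_trans T0)// T_mono.
  apply: le_trans (tau_le_excess UL UL1 F0 B0 g0 vg Tj h1 h2) _.
  by rewrite lee_fin lerD2l W_mono.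
have bad_sc k : (forall j, (k <= j <= 2 * k)%N -> ~ good j) ->
    ((W 0 (T (2 * k).+3))%:E <= sc k)%E.
  by move=> bad; exact: stage_cost_bad.
have [ex|none] := pselect (exists k, `[< exists2 j, (k <= j <= 2 * k)%N & good j >]).
  case: (ex_minnP ex) => k /asboolP[j /andP[_ jk] gj] kmin.
  apply: le_trans (tau_good j gj) _; rewrite EFinD -addeA leeD2l//.
  case: k jk kmin => [|k] jk kmin.
    move: jk; rewrite muln0 leqn0 => /eqP ->.
    by rewrite leeDl// nneseries_ge0.
  apply: (@le_trans _ _ (W 0 (T (2 * k).+3))%:E).
    by rewrite lee_fin W_mono// T_mono//; lia.
  apply: (@le_trans _ _ (sc k)).
    apply: bad_sc => i ik gi; have := kmin k; rewrite ltnn.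
    by move=> H; apply/notF/H; apply/asboolP; exists i.
  apply: le_trans (ge_sc k) _; rewrite leeDr// lee_fin sumr_ge0//.
(* If no window is good, every stage cost is at least [B 0 > 0], so the series diverges and the
   bound is trivial. *)
suff -> : (\sum_(0 <= k <oo) sc k = +oo)%E by rewrite addey// leey.
apply/eqyP => r r0.
apply: (@le_trans _ _ (\sum_(0 <= k < (Num.truncn (r / B 0%N)).+1) sc k)%E); last first.
  exact: nneseries_lim_ge.
apply: (@le_trans _ _ (\sum_(0 <= k < (Num.truncn (r / B 0%N)).+1) (B 0%N)%:E)%E).
  rewrite sumEFin lee_fin sumr_const_nat subn0 -mulr_natr mulrC -ler_pdivrMr//.
  by rewrite ltW// truncnS_gt.
apply: lee_sum => k _; apply: le_trans (bad_sc k _); last first.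
  by move=> j jk gj; apply: none; exists k; apply/asboolP; exists j.
rewrite lee_fin /W big_ltn ?lerDl ?sumr_ge0//.
by apply: leq_trans T0 _; exact: T_mono.
Qed.

(** * Real estimates *)

Section real_estimates.
Context {R : realType}.
Implicit Types (a s : R).

(** From [X^(m+1) / (m+1)! <= exp X] at [X = - (i + 1) ln a]. *)
Lemma exprn_le_poly a (m : nat) : 0 < a < 1 ->
  exists2 D : R, 0 <= D & forall i : nat, a ^+ i <= D / i.+1%:R ^+ m.+1.
Proof.
move=> /andP[a0 a1]; pose t := - ln a.
have t0 : 0 < t by rewrite oppr_gt0 ln_lt0// a0.
have aE i : a ^+ i = expR (- (t * i%:R)).
  by rewrite -mulNr opprK expRM_natr lnK.
exists (expR t * (m.+1)`!%:R / t ^+ m.+1).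
  by rewrite divr_ge0 ?mulr_ge0 ?expR_ge0// exprn_ge0// ltW.
move=> i; set X := t * i.+1%:R.
have X0 : 0 <= X by rewrite mulr_ge0// ltW.
have HX : X ^+ m.+1 <= expR X * (m.+1)`!%:R.
  rewrite -ler_pdivrMr ?ltr0n ?fact_gt0//.
  by apply: le_trans (expR_ge1Dxn m X0); rewrite lerDr.
rewrite ler_pdivlMr ?exprn_gt0// ler_pdivlMr ?exprn_gt0// -mulrA -exprMn.
rewrite [_ * t]mulrC -/X.
have -> : a ^+ i = expR t * expR (- X).
  by rewrite aE -expRD /X -natr1; congr expR; ring.
by rewrite -mulrA ler_wpM2l ?expR_ge0// expRN ler_pdivrMl ?expR_gt0.
Qed.

Lemma sum_inv_sqr_le (n : nat) : \sum_(0 <= i < n) (i.+1%:R ^+ 2)^-1 <= 2 :> R.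
Proof.
(* The strengthened bound telescopes, by [1/(n+2)^2 <= 1/(n+1) - 1/(n+2)]. *)
suff : \sum_(0 <= i < n.+1) (i.+1%:R ^+ 2)^-1 <= 2 - n.+1%:R^-1 :> R.
  rewrite big_nat_recr//= => H.
  apply: (le_trans (le_trans _ H)); last by rewrite gerBl invr_ge0.
  by rewrite lerDl invr_ge0 exprn_ge0.
elim: n => [|n IH]; first by rewrite big_nat1 expr1n invr1; lra.
rewrite big_nat_recr//=.
suff H : (n.+2%:R ^+ 2)^-1 <= n.+1%:R^-1 - n.+2%:R^-1 :> R.
  by apply: le_trans (lerD IH H) _; rewrite addrA subrK.
have n1 : 0 < n.+1%:R :> R by [].
have -> : n.+2%:R = n.+1%:R + 1 :> R by rewrite natr1.
set z : R := n.+1%:R in n1 *.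
have -> : z^-1 - (z + 1)^-1 = (z * (z + 1))^-1.
  by field; apply/andP; split; apply: lt0r_neq0; lra.
by rewrite lef_pV2 ?posrE ?exprn_gt0 ?mulr_gt0 ?addr_gt0//; nra.
Qed.

(** Two of the [q + 2] powers make the series converge; in the other [q] the lag is replaced by its
    least value [h]. *)
Lemma sum_lag_le s (q h m : nat) : 1 <= s -> (0 < h)%N ->
  \sum_(h <= i < m) (s / i.+1%:R) ^+ q.+2 <= 2 * s ^+ 2 * (s / h%:R) ^+ q.
Proof.
move=> s1 h0; have s0 : 0 <= s by lra.
have h0' : 0 < h%:R :> R by rewrite ltr0n.
apply: (@le_trans _ _ (\sum_(h <= i < m) ((s / h%:R) ^+ q * s ^+ 2 * (i.+1%:R ^+ 2)^-1))).
  rewrite !big_nat; apply: ler_sum => i /andP[hi _].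
  rewrite -addn2 exprD -mulrA; apply: ler_pM; rewrite ?exprn_ge0 ?divr_ge0//.
    rewrite lerXn2r ?nnegrE ?divr_ge0// ler_wpM2l// lef_pV2 ?posrE//.
    by rewrite ler_nat ltnW.
  by rewrite expr_div_n.
rewrite -mulr_sumr.
have -> : 2 * s ^+ 2 * (s / h%:R) ^+ q = (s / h%:R) ^+ q * s ^+ 2 * 2 by ring.
rewrite ler_wpM2l ?mulr_ge0 ?exprn_ge0 ?divr_ge0//.
apply: le_trans (sum_inv_sqr_le m).
have [hm|mh] := leqP h m; last first.
  rewrite big_geq 1?ltnW//; apply: sumr_ge0 => i _.
  by rewrite invr_ge0 exprn_ge0.
rewrite [leRHS](big_cat_nat (leq0n h) hm)/= lerDr; apply: sumr_ge0 => i _.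
by rewrite invr_ge0 exprn_ge0.
Qed.

Lemma sum_geometric_le a (h m : nat) : 0 <= a < 1 ->
  \sum_(h <= i < m) a ^+ i <= a ^+ h / (1 - a).
Proof.
move=> /andP[a0 a1]; have a1' : 0 < 1 - a by lra.
have [hm|mh] := leqP h m; last first.
  by rewrite big_geq 1?ltnW// divr_ge0 ?exprn_ge0// ltW.
rewrite ler_pdivlMr// mulr_suml.
have -> : \sum_(h <= i < m) a ^+ i * (1 - a) = a ^+ h - a ^+ m.
  have := telescope_sumr (fun i => a ^+ i) hm => /= H.
  rewrite -[RHS]opprB -H -sumrN.
  by apply: eq_bigr => i _; rewrite exprSr; ring.
by rewrite gerBl exprn_ge0.
Qed.

Lemma poly_exprn_small (C a e : R) (n : nat) : 0 < a < 1 -> 0 < e ->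
  exists N : nat, forall s : nat, (N <= s)%N -> C * s.+1%:R ^+ n * a ^+ s <= e.
Proof.
move=> a01 e0; have [D D0 HD] := exprn_le_poly n a01.
exists (Num.truncn (e^-1 * (`|C| * D))) => s Ns.
have s0 : 0 < s.+1%:R :> R by [].
apply: (@le_trans _ _ (`|C| * s.+1%:R ^+ n * (D / s.+1%:R ^+ n.+1))).
  apply: (@le_trans _ _ (`|C| * s.+1%:R ^+ n * a ^+ s)).
    rewrite ler_wpM2r//; first by rewrite exprn_ge0// ltW//; case/andP: a01.
    by rewrite ler_wpM2r ?exprn_ge0// ler_norm.
  by rewrite ler_wpM2l ?HD// mulr_ge0 ?exprn_ge0.
have -> : `|C| * s.+1%:R ^+ n * (D / s.+1%:R ^+ n.+1) = `|C| * D / s.+1%:R.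
  rewrite exprSr; field; rewrite expf_neq0 ?andbT//=; lra.
rewrite ler_pdivrMr// -ler_pdivrMl//; apply/ltW.
by apply: lt_le_trans (truncnS_gt _) _; rewrite ler_nat.
Qed.

Lemma count_below_le (z : R) (m : nat) : 0 <= z ->
  \sum_(1 <= i < m) ((i%:R < z)%R%:R : R) <= z.
Proof.
move=> z0; elim: m => [|m IH]; first by rewrite big_geq.
have [->|m0] := posnP m; first by rewrite big_geq.
rewrite big_nat_recr//=; case: (ltP m%:R z) => mz; last by rewrite addr0.
apply: le_trans (ltW mz).
apply: (@le_trans _ _ (\sum_(1 <= i < m) 1 + 1)).
  by rewrite lerD2r; apply: ler_sum => i _; case: (_ < z).
rewrite sumr_const_nat. rewrite -[X in _ + X <= _]/(1%:R) -natrD ler_nat; lia.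
Qed.

End real_estimates.

(** [b] is the [L]-th root of [s] rounded up, an integer substitute for [s^(1/L)]; the last clause
    bounds it from above. *)
Lemma least_root (L s : nat) : (0 < L)%N -> (0 < s)%N ->
  exists b : nat, [/\ (0 < b <= s)%N, (s <= b ^ L)%N & (b.-1 ^ L < s)%N].
Proof.
move=> L0 s0; have ex : exists b, (s <= b ^ L)%N.
  by exists s; rewrite -{1}(expn1 s) leq_pexp2l.
case: (ex_minnP ex) => b sb bmin; exists b; split => //.
  apply/andP; split; last by apply: bmin; rewrite -{1}(expn1 s) leq_pexp2l.
  by rewrite lt0n; apply/eqP => b0; move: sb; rewrite b0 exp0n// leqNgt s0.
have b0 : (0 < b)%N.
  by rewrite lt0n; apply/eqP => b0; move: sb; rewrite b0 exp0n// leqNgt s0.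
rewrite ltnNge; apply/negP => /bmin; by rewrite leqNgt prednK// leqnn.
Qed.

Section numeric.
Context {R : realType}.

Lemma sum_lag_bound (F : nat -> R) (D s : R) (q h m : nat) :
  (forall i, F i <= D * (s / i.+1%:R) ^+ q.+2) -> 0 <= D -> 1 <= s -> (0 < h)%N ->
  \sum_(h <= i < m) F i <= D * (2 * s ^+ 2 * (s / h%:R) ^+ q).
Proof.
move=> HF D0 s1 h0.
apply: (@le_trans _ _ (\sum_(h <= i < m) D * (s / i.+1%:R) ^+ q.+2)).
  by apply: ler_sum => i _; exact: HF.
by rewrite -mulr_sumr ler_wpM2l// sum_lag_le.
Qed.

(** Doubling puts the start of window [j + 1] at least [h 2^j] indices behind the end of window [j],
    so remote failures decay geometrically. The shift in the exponent keeps this gap positive at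
    [j = 0]. *)
Definition stage_index (h j : nat) : nat := (h * 2 ^ j.+1)%N.

Lemma stage_index_step h j : (stage_index h j + h <= stage_index h j.+1)%N.
Proof.
rewrite /stage_index [(2 ^ j.+2)%N]expnS mulnCA mul2n -addnn leq_add2l.
by rewrite leq_pmulr// expn_gt0.
Qed.

Let lag_ge h j : (h * 2 ^ j <= stage_index h j.+1 - (stage_index h j + h))%N.
Proof.
rewrite /stage_index !expnS [(h * (2 * (2 * _)))%N]mulnCA [(h * (2 * 2 ^ j))%N]mulnCA.
have : (h <= h * 2 ^ j)%N by rewrite leq_pmulr// expn_gt0.
move: (h * 2 ^ j)%N => X; lia.
Qed.

(** All lags are at least [s b 2^j], so the sum is at most [2 D s^2 (b 2^j)^-q]; here [b^q >= s^2]
    absorbs [s^2], and [q >= 3] leaves [8^-j]. *)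
Lemma remote_lag_bound (F : nat -> R) (D : R) (q s b j m : nat) :
  (0 < s)%N -> (0 < b)%N -> (s ^ 2 <= b ^ q)%N -> (2 < q)%N -> 0 <= D ->
  (forall i, F i <= D * (s%:R / i.+1%:R) ^+ q.+2) ->
  \sum_(0 <= n < m) F (stage_index (s * b) j.+1 + n -
    (stage_index (s * b) j + s * b))%N <= 2 * D * (8^-1) ^+ j.
Proof.
move=> s0 b0 sb q2 D0 HF; pose T := stage_index (s * b).
rewrite -/(T j) -/(T j.+1).
have s1 : 1 <= s%:R :> R by rewrite ler1n.
set X := (s * b * 2 ^ j)%N; have X0 : (0 < X)%N by rewrite !muln_gt0 s0 b0 expn_gt0.
set l := (T j.+1 - (T j + s * b))%N.
have Xl : (X <= l)%N by exact: lag_ge.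
have -> : \sum_(0 <= n < m) F (T j.+1 + n - (T j + s * b))%N = \sum_(l <= i < m + l) F i.
  rewrite -(add0n l) big_addn add0n addnK; apply: eq_bigr => n _.
  by rewrite /l addnBA ?stage_index_step// addnC.
apply: le_trans (sum_lag_bound _ HF D0 s1 (leq_trans X0 Xl)) _.
have -> : 2 * D * 8^-1 ^+ j = D * (2 * 8^-1 ^+ j) by ring.
rewrite ler_wpM2l// -[2 * _ * _]mulrA ler_wpM2l//.
have b0' : 0 < b%:R :> R by rewrite ltr0n.
have s0' : 0 < s%:R :> R by rewrite ltr0n.
have j0 : 0 < 2 ^+ j :> R by rewrite exprn_gt0.
apply: (@le_trans _ _ (s%:R ^+ 2 * (b%:R^-1 * (2 ^+ j)^-1) ^+ q)).
  rewrite ler_wpM2l ?exprn_ge0//; apply: lerXn2r.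
  - by rewrite nnegrE divr_ge0.
  - by rewrite nnegrE mulr_ge0 ?invr_ge0 ?ltW.
  have -> : b%:R^-1 * (2 ^+ j)^-1 = s%:R / X%:R :> R.
    rewrite /X !natrM natrX; field.
    by rewrite !gt_eqF//= -natrX ltr0n expn_gt0.
  rewrite ler_wpM2l// lef_pV2 ?posrE ?ltr0n ?ler_nat//.
  exact: leq_trans Xl.
rewrite exprMn mulrA -[leRHS]mul1r; apply: ler_pM.
- by rewrite mulr_ge0 ?exprn_ge0 ?invr_ge0 ?ltW.
- by rewrite exprn_ge0// invr_ge0 ltW.
- by rewrite exprVn ler_pdivrMr ?exprn_gt0// mul1r -!natrX ler_nat.
rewrite -!exprVn -exprM mulnC exprM lerXn2r// ?nnegrE ?exprn_ge0 ?invr_ge0//.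
rewrite -(subnKC q2) exprD.
have -> : (2^-1 : R) ^+ 3 = 8^-1 by rewrite exprVn; congr (_^-1); ring.
rewrite ler_piMr ?invr_ge0//; apply: exprn_ile1; rewrite ?invr_ge0//.
by rewrite invf_le1// ler1n.
Qed.

Lemma stage_sum_bound (h m : nat) (z D : R) : 0 <= z -> 0 <= D ->
  \sum_(0 <= k < m) ((stage_index h (2 * k).+3)%:R * z *
    ((8^-1) ^+ k.+1 + \sum_(k <= j < (2 * k).+1) D * (8^-1) ^+ j)) <=
  32 * h%:R * z * (1 + 2 * D).
Proof.
move=> z0 D0.
have e0 k : 0 <= (8^-1 : R) ^+ k by rewrite exprn_ge0.
(* The index [h 2^(2k+4) = 16 h 4^k] against failures of order [8^-k] leaves [2^-k]. *)
apply: (@le_trans _ _ (\sum_(0 <= k < m) (16 * h%:R * z * (1 + 2 * D)) * (2^-1) ^+ k)).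
  apply: ler_sum => k _.
  have -> : (stage_index h (2 * k).+3)%:R = 16 * h%:R * 4 ^+ k :> R.
    rewrite /stage_index natrM natrX -addn4 exprD exprM.
    have -> : (2 : R) ^+ 2 = 4 by ring.
    by ring.
  have -> : (2^-1 : R) ^+ k = 4 ^+ k * 8^-1 ^+ k.
    by rewrite -exprMn; congr (_ ^+ _); field.
  have hz : 0 <= 16 * h%:R * z * 4 ^+ k by rewrite !mulr_ge0// exprn_ge0.
  have -> : 16 * h%:R * z * (1 + 2 * D) * (4 ^+ k * 8^-1 ^+ k) =
     16 * h%:R * z * 4 ^+ k * ((1 + 2 * D) * 8^-1 ^+ k) by ring.
  rewrite [16 * h%:R * 4 ^+ k * z]mulrAC ler_wpM2l//.
  rewrite -mulr_sumr mulrDl mul1r; apply: lerD.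
    by rewrite exprS ler_piMl// invf_le1// ler1n.
  rewrite [2 * D]mulrC -mulrA ler_wpM2l//.
  have g8 : 0 <= (8^-1 : R) < 1 by lra.
  apply: le_trans (sum_geometric_le k (2 * k).+1 g8) _.
  have i8 : (1 - 8^-1)^-1 <= 2 :> R by rewrite invf_ple ?posrE; lra.
  by rewrite mulrC ler_wpM2r.
rewrite -mulr_sumr.
have g2 : 0 <= (2^-1 : R) < 1 by lra.
have G := sum_geometric_le 0 m g2.
have c0 : 0 <= 16 * h%:R * z * (1 + 2 * D).
  by rewrite !mulr_ge0// addr_ge0// mulr_ge0.
apply: le_trans (ler_wpM2l c0 G) _.
by rewrite expr0 le_eqVlt; apply/orP; left; apply/eqP; field.
Qed.

Lemma expR_sub1_le (eta : R) : expR eta - 1 <= eta * expR eta.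
Proof.
have := expR_ge1Dx (- eta); rewrite expRN => H.
have : (1 - eta) * expR eta <= 1.
  by rewrite -ler_pdivlMr ?expR_gt0// mul1r.
lra.
Qed.

(** With [eta = ln m] for some [1 < m < lam / kap], the inequality
    [exp eta - 1 <= eta exp eta = eta m] bounds the exponent by [- s eta (lam - m kap)]. *)
Lemma chernoff_exponent (kap lam : R) : 0 < kap < lam ->
  exists eta a : R, [/\ 0 < eta, 0 < a < 1 & forall (s : nat) (Pi K : R),
    Pi <= s%:R * kap -> s%:R * lam <= K ->
    expR ((expR eta - 1) * Pi - eta * K) <= a ^+ s].
Proof.
move=> /andP[k0 kl]; pose m := (lam / kap + 1) / 2.
have lk : 1 < lam / kap by rewrite ltr_pdivlMr// mul1r.
have m1 : 1 < m by rewrite /m; lra.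
have mk : m * kap < lam by rewrite -ltr_pdivlMr// /m; lra.
pose eta := ln m; have e0 : 0 < eta by rewrite ln_gt0.
have em : expR eta = m by rewrite lnK// posrE; lra.
pose g := eta * (lam - m * kap).
have g0 : 0 < g by rewrite mulr_gt0// subr_gt0.
exists eta, (expR (- g)); split => //.
  by rewrite expR_gt0/= expR_lt1 oppr_lt0.
move=> s Pi K HPi HK; rewrite -expRM_natl ler_expR.
have s0 : 0 <= s%:R :> R by [].
have e1 : 0 <= expR eta - 1 by rewrite em; lra.
have h1 : (expR eta - 1) * Pi <= eta * m * (s%:R * kap).
  apply: (@le_trans _ _ ((expR eta - 1) * (s%:R * kap))); first by rewrite ler_wpM2l.
  rewrite ler_wpM2r ?mulr_ge0 ?(ltW k0)//.
  by apply: le_trans (expR_sub1_le _) _; rewrite em.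
have h2 : eta * (s%:R * lam) <= eta * K by rewrite ler_wpM2l// ltW.
apply: (@le_trans _ _ (eta * m * (s%:R * kap) - eta * (s%:R * lam))); first exact: lerB.
by rewrite /g le_eqVlt; apply/orP; left; apply/eqP; ring.
Qed.

End numeric.

(** * Expectations over independent windows *)

Section independent_primitives.
Context {d : measure_display} {Omega : measurableType d} {R : realType}.
Variable P : probability Omega R.
Variables (x v : nat -> Omega -> R) (kappa alpha xi : R).
Hypothesis mx : forall i, measurable_fun setT (x i).
Hypothesis mv : forall i, measurable_fun setT (v i).
Hypothesis indep_xv : forall (m : nat) (A B : nat -> set R),
  (forall i, measurable (A i)) -> (forall i, measurable (B i)) ->
  P (\bigcap_(i in `I_m) (x i @^-1` A i) `&` \bigcap_(i in `I_m) (v i @^-1` B i)) =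
  (\prod_(i < m) P (x i @^-1` A i) * \prod_(i < m) P (v i @^-1` B i))%E.
Hypothesis alpha_gt0 : 0 < alpha.
Hypothesis alpha_le1 : alpha <= 1.
Hypothesis kappa_ge0 : 0 <= kappa.
Hypothesis x_laplace : forall i,
  (\int[P]_w (expR (- (kappa * `|x i w|)))%:E <= alpha%:E)%E.
Hypothesis x_mean : forall i, (\int[P]_w (`|x i w|)%:E <= xi%:E)%E.

Let integral1_le1 : (\int[P]_w (1 : R)%:E <= 1%:E)%E.
Proof. by rewrite integral_cst//= probability_setT mul1e. Qed.

(** The two families are concatenated into one of [2 m] variables, to which [integral_prod_indep_le]
    applies. *)
Lemma integral_prod_xv_le (m : nat) (f g : nat -> R -> R) (a b : nat -> R) :
  (forall i, measurable_fun setT (f i)) -> (forall i y, 0 <= f i y) ->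
  (forall i, measurable_fun setT (g i)) -> (forall i y, 0 <= g i y) ->
  (forall i, (\int[P]_w (f i (x i w))%:E <= (a i)%:E)%E) ->
  (forall i, (\int[P]_w (g i (v i w))%:E <= (b i)%:E)%E) ->
  (\int[P]_w (\prod_(0 <= i < m) (f i (x i w) * g i (v i w)))%:E <=
   (\prod_(0 <= i < m) (a i * b i))%:E)%E.
Proof.
move=> mf f0 mg g0 fa gb.
pose sel (T : Type) (X Y : nat -> T) (i : nat) := if (i < m)%N then X i else Y (i - m)%N.
have selE (S : Type) (X Y : nat -> S) : (forall i : 'I_m, sel _ X Y (lshift m i) = X i)
    * (forall i : 'I_m, sel _ X Y (rshift m i) = Y i).
  split=> i; rewrite /sel /=; first by rewrite ltn_ord.
  by rewrite ltnNge leq_addr/= addKn.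
have E (X Y : nat -> R) : \prod_(0 <= i < m) (X i * Y i) =
    \prod_(i < m + m) sel _ X Y i.
  rewrite big_split/= !big_mkord big_split_ord/=.
  by congr (_ * _); apply: eq_bigr => i _; rewrite selE.
under eq_integral do rewrite (E (fun i => f i (x i _)) (fun i => g i (v i _))).
rewrite E.
have -> : (fun w => (\prod_(i < m + m) sel _ (fun i => f i (x i w))
      (fun i => g i (v i w)) i)%:E) =
    (fun w => (\prod_(i < m + m) sel _ f g i (sel _ x v i w))%:E).
  apply/funext => w; congr EFin; apply: eq_bigr => i _.
  by rewrite /sel; case: ifP.
apply: integral_prod_indep_le.
- by move=> i _; rewrite /sel; case: ifP.
- move=> B mB.
  have := @indep_xv m B (fun i => B (m + i)%N) mB (fun i => mB _).
  rewrite big_split_ord/=.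
  under [in X in _ = X -> _]eq_bigr do rewrite -(selE _ x v).1.
  under [in X in _ = (_ * X)%E -> _]eq_bigr do rewrite -(selE _ x v).2.
  move=> <-; congr (P _); apply/seteqP; split=> w /=.
    move=> H; split=> i /= im.
      by have := H i; rewrite /sel/= im; apply; rewrite ltn_addr.
    have := H (m + i)%N; rewrite /sel/= [(_ < m)%N]ltnNge leq_addr/= addKn; apply.
    by rewrite ltn_add2l.
  move=> [H1 H2] i /= im; rewrite /sel; case: ltnP => [|mi]; first exact: H1.
  have := H2 (i - m)%N; rewrite /= subnKC//; apply.
  by rewrite ltn_subLR.
- by move=> i; rewrite /sel; case: ifP.
- by move=> i y; rewrite /sel; case: ifP.
- by move=> i _; rewrite /sel; case: ifP.
Qed.

(** Tests see an interarrival time only through this weight. It is at most 1, which is what makes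
    [past_le_x] hold. *)
Definition factor (e : bool) (y : R) : R := if e then expR (- (kappa * `|y|)) else 1.

Definition test_prod N M (e : nat -> bool) (g : nat -> R -> R) (w : Omega) : R :=
  \prod_(N <= l < M) (factor (e l) (x l w) * g l (v l w)).

Definition test_bound N M (e : nat -> bool) (b : nat -> R) : R :=
  \prod_(N <= l < M) ((if e l then alpha else 1) * b l).

Definition test_ok (g : nat -> R -> R) (b : nat -> R) :=
  [/\ forall l, measurable_fun setT (g l), forall l y, 0 <= g l y &
      forall l, (\int[P]_w (g l (v l w))%:E <= (b l)%:E)%E].

(* An inequality form of: [Psi] is independent of the primitives of index at
   least [N], and has mean at most [c]. *)
Definition past_le N (Psi : Omega -> R) (c : R) :=
  [/\ measurable_fun setT Psi, forall w, 0 <= Psi w, 0 <= c &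
   forall M e g b, test_ok g b ->
    (\int[P]_w (Psi w * test_prod N M e g w)%:E <= (c * test_bound N M e b)%:E)%E].

(** Stated as an action on [past_le] bounds, so that functionals of consecutive windows can be
    multiplied without conditional expectations. *)
Definition window_le N M (Phi : Omega -> R) (p : R) :=
  [/\ measurable_fun setT Phi, forall w, 0 <= Phi w, 0 <= p &
   forall Psi c, past_le N Psi c -> past_le M (fun w => Psi w * Phi w) (c * p)].

Let mfactor e : measurable_fun setT (factor e).
Proof.
rewrite /factor; case: e => //.
apply: measurableT_comp => //; apply: measurableT_comp => //.
by apply: measurable_funM => //; exact: normr_measurable.
Qed.

Let factor_ge0 e y : 0 <= factor e y.
Proof. by rewrite /factor; case: e => //; exact: expR_ge0. Qed.

Let factor_le1 e y : factor e y <= 1.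
Proof.
by rewrite /factor; case: e => //; rewrite -expR0 ler_expR oppr_le0 mulr_ge0.
Qed.

Let factor_int e i : (\int[P]_w (factor e (x i w))%:E <=
  (if e then alpha else 1)%:E)%E.
Proof.
by case: e => //=; exact: integral1_le1.
Qed.

Let mtest N M e g b : test_ok g b -> measurable_fun setT (test_prod N M e g).
Proof.
move=> [mg _ _]; apply: measurable_prod => l _; apply: measurable_funM.
  by apply: measurableT_comp.
by apply: measurableT_comp.
Qed.

Let test_ge0 N M e g b w : test_ok g b -> 0 <= test_prod N M e g w.
Proof. by move=> [_ g0 _]; apply: prodr_ge0 => l _; rewrite mulr_ge0. Qed.

Let test_ok_ge0 g b l : test_ok g b -> 0 <= b l.
Proof.
move=> [_ g0 gb]; rewrite -lee_fin; apply: le_trans (gb l).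
by apply: integral_ge0 => w _; rewrite lee_fin.
Qed.

Let alpha_ge0 (e : bool) : 0 <= (if e then alpha else 1).
Proof. by case: e => //; exact: ltW. Qed.

Let bound_ge0 N M e g b : test_ok g b -> 0 <= test_bound N M e b.
Proof.
move=> ok; apply: prodr_ge0 => l _; rewrite mulr_ge0//.
exact: test_ok_ge0 ok.
Qed.

Lemma past_le1 : past_le 0 (cst 1) 1.
Proof.
split=> // M e g b ok; rewrite mul1r.
under eq_integral do rewrite mul1r.
case: ok => mg g0 gb.
apply: (@integral_prod_xv_le M (fun i => factor (e i)) g
  (fun i => if e i then alpha else 1) b) => //.
Qed.

(** This is not independence: [x i] may also occur in the test. As [factor] is at most 1, its
    product with [|x i|] has mean at most [xi], hence at most [xi / alpha] times the bound ([alpha]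
    or 1) of that factor. *)
Let past_le_x i : past_le 0 (fun w => `|x i w|) (xi / alpha).
Proof.
have xi0 : 0 <= xi.
  rewrite -lee_fin; apply: le_trans (x_mean 0%N).
  by apply: integral_ge0 => w _; rewrite lee_fin.
split=> //; [by apply: measurableT_comp => //; exact: normr_measurable|
  by rewrite divr_ge0// ltW|].
move=> M e g b ok.
(* The test is padded with trivial factors so that coordinate [i] occurs even when [i >= M]. *)
pose M' := maxn M i.+1.
pose e' l := (l < M)%N && e l.
pose g' l := if (l < M)%N then g l else cst 1.
pose b' l := if (l < M)%N then b l else 1.
pose f l (y : R) : R := (if l == i then `|y| else 1) * factor (e' l) y.
pose a l := (if l == i then xi / alpha else 1) * (if e' l then alpha else 1).
have iM : (i < M')%N by rewrite leq_max leqnn orbT.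
have MM : (M <= M')%N by rewrite leq_max leqnn.
have cut (F : nat -> R) : (forall l, (M <= l)%N -> F l = 1) ->
    \prod_(0 <= l < M') F l = \prod_(0 <= l < M) F l.
  move=> F1; rewrite (big_cat_nat (leq0n M) MM)/= [X in _ * X]big1_seq ?mulr1//.
  by move=> l /andP[_]; rewrite mem_index_iota => /andP[+ _]; exact: F1.
have one (F : nat -> R) z : \prod_(0 <= l < M') ((if l == i then z else 1) * F l) =
    z * \prod_(0 <= l < M') F l.
  rewrite big_split/=; congr (_ * _).
  rewrite (bigD1_seq i) ?iota_uniq ?mem_index_iota//= eqxx big1 ?mulr1//.
  by move=> l /negbTE ->.
have -> : xi / alpha * test_bound 0 M e b = \prod_(0 <= l < M') (a l * b' l).
  rewrite /a; under [RHS]eq_bigr do rewrite -mulrA.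
  rewrite one cut; last by move=> l; rewrite /e' /b' ltnNge => ->/=; rewrite mulr1.
  congr (_ * _); rewrite /test_bound !big_mkord; apply: eq_bigr => l _.
  by rewrite /e' /b' ltn_ord.
have -> : (fun w => (`|x i w| * test_prod 0 M e g w)%:E) =
    (fun w => (\prod_(0 <= l < M') (f l (x l w) * g' l (v l w)))%:E).
  apply/funext => w; congr EFin; rewrite /f.
  have E l : (if l == i then `|x l w| else 1) = (if l == i then `|x i w| else 1).
    by case: eqP => // ->.
  under [RHS]eq_bigr do rewrite -mulrA E.
  rewrite one cut; last first.
    by move=> l; rewrite /e' /g' ltnNge => ->/=; rewrite mulr1.
  congr (_ * _); rewrite /test_prod !big_mkord; apply: eq_bigr => l _.
  by rewrite /e' /g' ltn_ord.
case: ok => mg g0 gb; apply: (@integral_prod_xv_le M' f g' a b').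
- move=> l; apply: measurable_funM => //; case: (l == i) => //=.
- by move=> l y; rewrite mulr_ge0//; case: ifP.
- by move=> l; rewrite /g'; case: ifP.
- by move=> l y; rewrite /g'; case: ifP.
- move=> l; rewrite /f /a; case: eqVneq => [->|_]; last first.
    under eq_integral do rewrite mul1r.
    by rewrite mul1r; exact: factor_int.
  apply: (@le_trans _ _ xi%:E).
    apply: le_trans (x_mean i); apply: ge0_le_integral => //=.
    + by move=> w _; rewrite lee_fin mulr_ge0.
    + apply/measurable_EFinP; apply: measurable_funM.
        by apply: measurableT_comp => //; exact: normr_measurable.
      exact: measurableT_comp.
    + apply/measurable_EFinP.
      by apply: measurableT_comp => //; exact: normr_measurable.
    + by move=> w _; rewrite lee_fin ler_piMr.
  rewrite lee_fin; case: (e' i); first by rewrite divfK// gt_eqF.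
  by rewrite mulr1 ler_pdivlMr// ler_piMr.
- by move=> l; rewrite /g' /b'; case: ifP => // _; exact: integral1_le1.
Qed.

Lemma past_le_sum (I : Type) (r : seq I) N (Psi : I -> Omega -> R) (c : I -> R) :
  (forall i, past_le N (Psi i) (c i)) ->
  past_le N (fun w => \sum_(i <- r) Psi i w) (\sum_(i <- r) c i).
Proof.
move=> H; split.
- by apply: measurable_sum => i; have [] := H i.
- by move=> w; apply: sumr_ge0 => i _; have [_ +] := H i.
- by apply: sumr_ge0 => i _; have [] := H i.
move=> M e g b ok.
have -> : (fun w => ((\sum_(i <- r) Psi i w) * test_prod N M e g w)%:E) =
    fun w => (\sum_(i <- r) (Psi i w * test_prod N M e g w)%:E)%E.
  by apply/funext => w; rewrite mulr_suml sumEFin.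
rewrite ge0_integral_sum//.
- by rewrite mulr_suml -sumEFin; apply: lee_sum => i _; have [_ _ _] := H i; exact.
- move=> i; apply/measurable_EFinP; apply: measurable_funM.
    by have [] := H i.
  exact: mtest ok.
- move=> i w _; rewrite lee_fin mulr_ge0 ?(test_ge0 _ _ _ _ ok)//.
  by have [_ +] := H i.
Qed.

Lemma past_le_arrivals n : past_le 0 (fun w => \sum_(0 <= i < n) `|x i w|)
  (n%:R * (xi / alpha)).
Proof.
have := @past_le_sum _ (index_iota 0 n) _ _ _ past_le_x.
by rewrite sumr_const_nat subn0 mulr_natl.
Qed.

Lemma past_le_int N Psi c : past_le N Psi c -> (\int[P]_w (Psi w)%:E <= c%:E)%E.
Proof.
move=> [mPsi Psi0 c0 H].
have := H N (fun=> false) (fun=> cst 1) (fun=> 1).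
rewrite /test_prod /test_bound; under eq_integral do rewrite big_geq// mulr1.
by rewrite big_geq// mulr1; apply; split=> // l; exact: integral1_le1.
Qed.

Lemma window_le_int M Phi p : window_le 0 M Phi p -> (\int[P]_w (Phi w)%:E <= p%:E)%E.
Proof.
move=> [_ _ _ H]; have := past_le_int (H _ _ past_le1).
by rewrite mul1r; under eq_integral do rewrite mul1r.
Qed.

(** The summed interarrival times may be among those on which [Phi] depends; this overlap costs only
    the factor [1 / alpha]. *)
Lemma window_le_arrivals n M Phi p : window_le 0 M Phi p ->
  (\int[P]_w ((\sum_(0 <= i < n) `|x i w|) * Phi w)%:E <=
   (n%:R * (xi / alpha) * p)%:E)%E.
Proof. by move=> [_ _ _ H]; exact: past_le_int (H _ _ (past_le_arrivals n)). Qed.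

(** A test on [[N, M)] followed by a test on [[M, K)] is a single test on [[N, K)]. *)
Lemma window_le_test N M e g b : (N <= M)%N -> test_ok g b ->
  window_le N M (test_prod N M e g) (test_bound N M e b).
Proof.
move=> NM ok; split; [exact: mtest ok| |exact: bound_ge0 ok|].
  by move=> w; exact: test_ge0 ok.
move=> Psi c [mPsi Psi0 c0 H]; split.
- by apply: measurable_funM => //; exact: mtest ok.
- by move=> w; rewrite mulr_ge0// (test_ge0 _ _ _ _ ok).
- by rewrite mulr_ge0// (bound_ge0 _ _ _ ok).
(* For [K < M] the later test is an empty product. *)
move=> K e' g' b' ok'; have [MK|KM] := leqP M K; last first.
  rewrite {2}/test_bound big_geq 1?ltnW// mulr1.
  apply: le_trans (H M e g b ok); apply: ge0_le_integral => //=.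
  - move=> w _; rewrite lee_fin !mulr_ge0//.
      exact: test_ge0 ok.
    exact: test_ge0 ok'.
  - apply/measurable_EFinP; apply: measurable_funM; last exact: mtest ok'.
    by apply: measurable_funM => //; exact: mtest ok.
  - by apply/measurable_EFinP; apply: measurable_funM => //; exact: mtest ok.
  - by move=> w _; rewrite {2}/test_prod big_geq 1?ltnW// mulr1.
pose e2 l := if (l < M)%N then e l else e' l.
pose g2 l := if (l < M)%N then g l else g' l.
pose b2 l := if (l < M)%N then b l else b' l.
have ok2 : test_ok g2 b2.
  by case: ok ok' => [? ? ?] [? ? ?]; split => l; rewrite /g2 /b2; case: ifP.
have := H K e2 g2 b2 ok2; rewrite -mulrA.
have cat (F F1 F2 : nat -> R) : (forall l, (l < M)%N -> F l = F1 l) ->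
   (forall l, (M <= l)%N -> F l = F2 l) ->
   \prod_(N <= l < K) F l = (\prod_(N <= l < M) F1 l) * (\prod_(M <= l < K) F2 l).
  move=> h1 h2; rewrite (big_cat_nat NM MK)/=; congr (_ * _);
    rewrite !big_nat; apply: eq_bigr => l /andP[? ?]; [exact: h1|exact: h2].
congr (_ <= (c * _)%:E)%E.
  apply: eq_integral => w _; rewrite -mulrA; congr (_ * _)%:E.
  by apply: cat => l; rewrite /e2 /g2 ltnNge; [move/negbTE|move=> h]; rewrite ?h// => ->.
by apply: cat => l; rewrite /e2 /b2 ltnNge; [move/negbTE|move=> h]; rewrite ?h// => ->.
Qed.

Lemma past_le_mulr N Psi c k : 0 <= k -> past_le N Psi c ->
  past_le N (fun w => k * Psi w) (k * c).
Proof.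
move=> k0 [mPsi Psi0 c0 H]; split; [exact: measurable_funM| | |].
- by move=> w; rewrite mulr_ge0.
- by rewrite mulr_ge0.
move=> M e g b ok.
under eq_integral do rewrite -mulrA EFinM.
rewrite ge0_integralZl//.
- by rewrite -mulrA EFinM lee_wpmul2l ?lee_fin ?H.
- by apply/measurable_EFinP; apply: measurable_funM => //; exact: mtest ok.
- by move=> w _; rewrite lee_fin mulr_ge0// (test_ge0 _ _ _ _ ok).
Qed.

Lemma window_le_mulr N M Phi p k : 0 <= k -> window_le N M Phi p ->
  window_le N M (fun w => k * Phi w) (k * p).
Proof.
move=> k0 [mPhi Phi0 p0 H]; split; [exact: measurable_funM| | |].
- by move=> w; rewrite mulr_ge0.
- by rewrite mulr_ge0.
move=> Psi c /H /(past_le_mulr k0); congr past_le.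
  by apply/funext => w; rewrite mulrCA.
by rewrite mulrCA.
Qed.

Lemma window_le_sum (I : Type) (r : seq I) (Q : pred I) N M (Phi : I -> Omega -> R)
  (p : I -> R) : (forall i, Q i -> window_le N M (Phi i) (p i)) ->
  window_le N M (fun w => \sum_(i <- r | Q i) Phi i w) (\sum_(i <- r | Q i) p i).
Proof.
move=> H.
have zero : window_le N M (cst 0) 0.
  have past0 c K : 0 <= c -> past_le K (cst 0) c.
    move=> c0; split => // K' e g b ok; rewrite integral0_eq ?lee_fin.
      by rewrite mulr_ge0// (bound_ge0 _ _ _ ok).
    by move=> w _; rewrite mul0r.
  split=> // Psi c [? ? c0 _].
  have := past0 _ M (lexx 0); congr past_le; last by rewrite mulr0.
  by apply/funext => w; rewrite /= mulr0.
have {}H i : window_le N M (fun w => if Q i then Phi i w else 0) (if Q i then p i else 0).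
  by case: ifP => // Qi; exact: H.
have -> : (fun w => \sum_(i <- r | Q i) Phi i w) =
    (fun w => \sum_(i <- r) if Q i then Phi i w else 0).
  by apply/funext => w; rewrite big_mkcond.
rewrite big_mkcond/=; split.
- by apply: measurable_sum => i; have [] := H i.
- by move=> w; apply: sumr_ge0 => i _; have [_ +] := H i.
- by apply: sumr_ge0 => i _; have [] := H i.
move=> Psi c PL.
have := @past_le_sum _ r M (fun i w => Psi w * (if Q i then Phi i w else 0))
  (fun i => c * (if Q i then p i else 0)).
have E : (fun w => \sum_(i <- r) (Psi w * if Q i then Phi i w else 0)) =
  (fun w => Psi w * \sum_(i <- r) if Q i then Phi i w else 0).
  by apply/funext => w; rewrite mulr_sumr.
rewrite E -mulr_sumr; apply=> i.
by have [_ _ _] := H i; exact.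
Qed.

Lemma window_leD N M Phi1 Phi2 p1 p2 : window_le N M Phi1 p1 ->
  window_le N M Phi2 p2 -> window_le N M (fun w => Phi1 w + Phi2 w) (p1 + p2).
Proof.
move=> H1 H2.
have := @window_le_sum bool [:: true; false] xpredT N M
  (fun b => if b then Phi1 else Phi2) (fun b => if b then p1 else p2).
have -> : (fun w => \sum_(i <- [:: true; false]) (if i then Phi1 else Phi2) w) =
   (fun w => Phi1 w + Phi2 w).
  by apply/funext => w; rewrite !big_cons big_nil addr0.
by rewrite !big_cons big_nil addr0; apply; case.
Qed.

Lemma window_le_trans N M K Phi1 Phi2 p1 p2 : window_le N M Phi1 p1 ->
  window_le M K Phi2 p2 -> window_le N K (fun w => Phi1 w * Phi2 w) (p1 * p2).
Proof.
move=> [m1 f1 q1 H1] [m2 f2 q2 H2]; split.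
- exact: measurable_funM.
- by move=> w; rewrite mulr_ge0.
- by rewrite mulr_ge0.
move=> Psi c /H1/H2; rewrite -mulrA; congr past_le.
by apply/funext => w; rewrite -mulrA.
Qed.

Lemma window_le_cst1 N M : (N <= M)%N -> window_le N M (cst 1) 1.
Proof.
move=> NM; have := @window_le_test N M (fun=> false) (fun=> cst 1) (fun=> 1) NM.
have -> : test_bound N M (fun=> false) (fun=> 1) = 1.
  by rewrite /test_bound big1// => i _; rewrite mulr1.
have -> : test_prod N M (fun=> false) (fun=> cst 1) = cst 1.
  by apply/funext => w; rewrite /test_prod big1// => i _; rewrite mulr1.
by apply; split=> // l; exact: integral1_le1.
Qed.

(** Chaining consecutive windows takes the place of independence: the bounds multiply. *)
Lemma window_le_prod (T : nat -> nat) (Phi : nat -> Omega -> R) (p : nat -> R) i j :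
  (forall k, window_le (T k) (T k.+1) (Phi k) (p k)) -> (i <= j)%N ->
  window_le (T i) (T j) (fun w => \prod_(i <= k < j) Phi k w) (\prod_(i <= k < j) p k).
Proof.
move=> H; elim: j => [|j IH].
  rewrite leqn0 => /eqP ->; rewrite big_geq//.
  under eq_fun do rewrite big_geq//; exact: window_le_cst1.
rewrite leq_eqVlt => /predU1P[->|].
  rewrite big_geq//; under eq_fun do rewrite big_geq//; exact: window_le_cst1.
rewrite ltnS => ij; rewrite big_nat_recr//=.
under eq_fun do rewrite big_nat_recr//=.
by apply: window_le_trans (IH ij) (H j).
Qed.

Lemma window_le_weaken N M Phi p q : p <= q -> window_le N M Phi p -> window_le N M Phi q.
Proof.
move=> pq [m f p0 H]; split=> //; first exact: le_trans pq.
move=> Psi c PL; have [? ? ? K] := H _ _ PL; have [_ _ c0 _] := PL; split=> //.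
  by rewrite mulr_ge0// (le_trans p0).
move=> M' e g b ok; apply: le_trans (K _ _ _ _ ok) _.
by rewrite lee_fin ler_wpM2r ?(bound_ge0 _ _ _ ok)// ler_wpM2l.
Qed.

End independent_primitives.

Lemma measurable_gt_indic {R : realType} (z : R) :
  measurable_fun setT (fun t : R => (z < t)%R%:R : R).
Proof.
have -> : (fun t : R => (z < t)%R%:R : R) = \1_(`]z, +oo[%classic).
  by apply/funext => t; rewrite indicE mem_setE in_itv/= andbT.
exact: measurable_indic.
Qed.

Lemma integral_nneseries_le {d : measure_display} {Omega : measurableType d}
  {R : realType} (P : probability Omega R) (f : nat -> Omega -> \bar R)
  (u : nat -> R) (c : R) :
  (forall n, measurable_fun setT (f n)) -> (forall n w, (0 <= f n w)%E) ->
  (forall n, (\int[P]_w f n w <= (u n)%:E)%E) ->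
  (forall m, \sum_(0 <= n < m) u n <= c) ->
  (\int[P]_w \sum_(0 <= n <oo) f n w <= c%:E)%E.
Proof.
move=> mf f0 fu uc; rewrite integral_nneseries//.
apply: lime_le.
  by apply: is_cvg_nneseries => n _ _; apply: integral_ge0.
apply: nearW => m; apply: (@le_trans _ _ (\sum_(0 <= n < m) (u n)%:E)%E).
  by apply: lee_sum => i _; exact: fu.
by rewrite sumEFin lee_fin.
Qed.

(** * Means of the stage costs and of the excess *)

Section stage_expectation.
Context {d : measure_display} {Omega : measurableType d} {R : realType}.
Variable P : probability Omega R.
Variables (x v : nat -> Omega -> R) (V : Omega -> R) (kappa alpha xi : R).
Hypothesis mx : forall i, measurable_fun setT (x i).
Hypothesis mv : forall i, measurable_fun setT (v i).
Hypothesis mV : measurable_fun setT V.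
Hypothesis indep_xv : forall (m : nat) (A B : nat -> set R),
  (forall i, measurable (A i)) -> (forall i, measurable (B i)) ->
  P (\bigcap_(i in `I_m) (x i @^-1` A i) `&` \bigcap_(i in `I_m) (v i @^-1` B i)) =
  (\prod_(i < m) P (x i @^-1` A i) * \prod_(i < m) P (v i @^-1` B i))%E.
Hypothesis alpha_gt0 : 0 < alpha.
Hypothesis alpha_le1 : alpha <= 1.
Hypothesis kappa_ge0 : 0 <= kappa.
Hypothesis x_laplace : forall i,
  (\int[P]_w (expR (- (kappa * `|x i w|)))%:E <= alpha%:E)%E.
Hypothesis x_mean : forall i, (\int[P]_w (`|x i w|)%:E <= xi%:E)%E.
Hypothesis v_law : forall i (g : R -> R), measurable_fun setT g ->
  (forall z, 0 <= g z) ->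
  (\int[P]_w (g (v i w))%:E = \int[P]_w (g (V w))%:E)%E.

Variables (y p : nat -> R) (eta a : R).
Hypothesis eta_gt0 : 0 < eta.
Hypothesis a_itv : 0 < a < 1.
Hypothesis y_lin : forall i, expR (kappa * y i) * alpha ^+ i = a ^+ i.
Hypothesis p_tail : forall i, (\int[P]_w ((y i < V w)%R%:R : R)%:E <= (p i)%:E)%E.

Let win := window_le P x v kappa alpha.
Let B w := fun l => `|x l w|.
Let S w := fun l => v l w.

Let int1 : (\int[P]_w (1 : R)%:E <= 1%:E)%E.
Proof. by rewrite integral_cst//= probability_setT mul1e. Qed.

Let p_ge0 i : 0 <= p i.
Proof.
rewrite -lee_fin; apply: le_trans (p_tail i).
by apply: integral_ge0 => w _; rewrite lee_fin.
Qed.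

Lemma window_le_service N M n (g : R -> R) b : (N <= n < M)%N ->
  measurable_fun setT g -> (forall z, 0 <= g z) ->
  (\int[P]_w (g (V w))%:E <= b%:E)%E -> win N M (fun w => g (v n w)) b.
Proof.
move=> /andP[Nn nM] mg g0 gb.
have ok : test_ok P v (fun l => if l == n then g else cst 1)
    (fun l => if l == n then b else 1).
  by split=> [l|l z|l]; case: eqVneq => // _; try by rewrite v_law.
have := window_le_test kappa mx mv alpha_gt0
  (fun=> false) (ltnW (leq_ltn_trans Nn nM)) ok.
congr window_le.
  apply/funext => w; rewrite /test_prod (bigD1_seq n) ?iota_uniq//=; last first.
    by rewrite mem_index_iota Nn.
  rewrite eqxx mul1r big1 ?mulr1// => i /negbTE ->; by rewrite mulr1.
rewrite /test_bound (bigD1_seq n) ?iota_uniq//=; last by rewrite mem_index_iota Nn.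
by rewrite eqxx mul1r big1 ?mulr1// => i /negbTE ->; rewrite mulr1.
Qed.

Let win_late N M k n : (N <= n < M)%N ->
  win N M (fun w => late y (S w) k n) (p (n - k)).
Proof.
move=> NnM.
by apply: (@window_le_service N M n (fun t => (y (n - k) < t)%R%:R)) => //;
  exact: measurable_gt_indic.
Qed.

(** The Laplace transforms of the [n - k] interarrival times give [alpha^(n-k)], and [y_lin] turns
    the product with [exp (kappa y)] into [a^(n-k)]. *)
Lemma window_le_fast N M k n : (N <= k <= n)%N -> (n <= M)%N ->
  win N M (fun w => fast y kappa (B w) k n) (a ^+ (n - k)).
Proof.
move=> /andP[Nk kn] nM.
have ok : test_ok P v (fun=> cst 1) (fun=> 1).
  by split=> // l; exact: int1.
have NM : (N <= M)%N by rewrite (leq_trans Nk)// (leq_trans kn).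
have := window_le_test kappa mx mv alpha_gt0
  (fun l => (k <= l < n)%N) NM ok.
move=> /(window_le_mulr mx mv (expR_ge0 (kappa * y (n - k)%N))).
have sel (F : nat -> R) : (forall l, ~~ (k <= l < n)%N -> F l = 1) ->
    \prod_(N <= l < M) F l = \prod_(k <= l < n) F l.
  move=> F1; rewrite (big_cat_nat (n := k))//=; last exact: leq_trans nM.
  rewrite [X in X * _]big1_seq ?mul1r; last first.
    move=> l /andP[_]; rewrite mem_index_iota => /andP[_ lk].
    by apply: F1; rewrite leqNgt lk.
  rewrite (big_cat_nat kn)//= [X in _ * X]big1_seq ?mulr1//.
  move=> l /andP[_]; rewrite mem_index_iota => /andP[nl _].
  by apply: F1; rewrite ltnNge nl andbF.
congr window_le.
  apply/funext => w; rewrite /fast mulrBr expRD; congr (_ * _).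
  rewrite /test_prod sel => [|l /negbTE ->]; last by rewrite mulr1.
  rewrite mulr_sumr -sumrN expR_sum !big_nat; apply: eq_bigr => l kln.
  by rewrite /factor kln mulr1.
rewrite /test_bound sel => [|l /negbTE ->]; last by rewrite mulr1.
rewrite -y_lin; congr (_ * _); rewrite -prodr_const_nat !big_nat.
by apply: eq_bigr => l ->; rewrite mulr1.
Qed.

(** Each late indicator has exponential moment at most [1 + (exp eta - 1) p <= exp ((exp eta - 1)
    p)]; over independent services the exponents add up. *)
Lemma window_le_crowd N M k i0 K Pi : (N <= k <= M)%N ->
  \sum_(k + i0 <= n < M) p (n - k) <= Pi ->
  win N M (fun w => crowd y eta (S w) K i0 M k) (expR ((expR eta - 1) * Pi - eta * K)).
Proof.
move=> /andP[Nk kM] HPi.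
have e1 : 0 <= expR eta - 1 by rewrite subr_ge0 -expR0 ler_expR ltW.
pose g l (z : R) := if (k + i0 <= l)%N then expR (eta * (y (l - k)%N < z)%R%:R) else 1.
pose b l := if (k + i0 <= l)%N then expR ((expR eta - 1) * p (l - k)) else 1.
have ok : test_ok P v g b.
  have mg l : measurable_fun setT (g l).
    rewrite /g; case: leqP => // _; apply: measurableT_comp => //.
    by apply: measurable_funM => //; exact: measurable_gt_indic.
  have g0 l z : 0 <= g l z by rewrite /g; case: leqP => // _; exact: expR_ge0.
  split=> // l; rewrite v_law// /g /b; case: leqP => _; last exact: int1.
  have -> : (fun w => (expR (eta * (y (l - k)%N < V w)%R%:R))%:E) =
      (fun w => 1%:E + (expR eta - 1)%:E * ((y (l - k)%N < V w)%R%:R : R)%:E)%E.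
    apply/funext => w; case: (_ < _); rewrite ?mulr1 ?mulr0 ?expR0 ?mule1 ?mule0 ?adde0//.
    by rewrite -EFinD addrC subrK.
  have mi : measurable_fun setT (fun w => ((y (l - k)%N < V w)%R%:R : R)%:E).
    by apply/measurable_EFinP; apply: (measurableT_comp (measurable_gt_indic _)).
  rewrite ge0_integralD//; last 2 first.
    by move=> w _; rewrite -EFinM lee_fin mulr_ge0.
    exact: measurable_funeM.
  rewrite ge0_integralZl//.
  apply: (@le_trans _ _ (1%:E + (expR eta - 1)%:E * (p (l - k))%:E)%E).
    by apply: leeD; [exact: int1|apply: lee_wpmul2l; rewrite ?lee_fin].
  by rewrite -EFinM -EFinD lee_fin expR_ge1Dx.
have NM : (N <= M)%N by exact: leq_trans kM.
have := window_le_test kappa mx mv alpha_gt0 (fun=> false) NM ok.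
move=> /(window_le_mulr mx mv (expR_ge0 (- (eta * K)))) H.
have sel (F G : nat -> R) : (forall l, (k + i0 <= l)%N -> F l = G l) ->
    (forall l, (l < k + i0)%N -> F l = 1) ->
    \prod_(N <= l < M) F l = \prod_(k + i0 <= l < M) G l.
  move=> FG F1; have [kiM|Mki] := leqP (k + i0) M; last first.
    rewrite [RHS]big_geq 1?ltnW// big1_seq// => l /andP[_].
    by rewrite mem_index_iota => /andP[_ lM]; apply: F1; exact: ltn_trans Mki.
  rewrite (big_cat_nat (n := (k + i0)%N))//=; last by rewrite (leq_trans Nk)// leq_addr.
  rewrite [X in X * _]big1_seq ?mul1r; last first.
    by move=> l /andP[_]; rewrite mem_index_iota => /andP[_]; exact: F1.
  by rewrite !big_nat; apply: eq_bigr => l /andP[? _]; exact: FG.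
apply: (window_le_weaken alpha_gt0 (p := expR (- (eta * K)) * test_bound alpha N M (fun=> false) b)).
  rewrite /test_bound (sel _ (fun l => expR ((expR eta - 1) * p (l - k)))); last 2 first.
  - by move=> l kl; rewrite /b kl mul1r.
  - by move=> l lk; rewrite /b leqNgt lk mul1r.
  rewrite -expR_sum -expRD ler_expR -mulr_sumr addrC lerD2r.
  by rewrite ler_wpM2l.
move: H; congr window_le.
apply/funext => w; rewrite /crowd mulrBr expRD mulrC; congr (_ * _).
rewrite /test_prod (sel _ (fun l => expR (eta * late y (S w) k l))).
- by rewrite -expR_sum mulr_sumr.
- by move=> l kl; rewrite /g kl /factor mul1r.
- by move=> l lk; rewrite /g leqNgt lk /factor mul1r.
Qed.

(** [q1] pays for late customers older than the window, [q2] for the [fast] sums at its [h + 1]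
    indices, [q3] for the crowds there. *)
Lemma window_failure_le N M h i0 K Pi q1 q2 q3 : (N + h <= M)%N ->
  (forall m, \sum_(h <= i < m) p i <= q1) ->
  h.+1%:R * (a ^+ i0 / (1 - a)) <= q2 ->
  (forall m, \sum_(i0 <= i < m) p i <= Pi) ->
  h.+1%:R * expR ((expR eta - 1) * Pi - eta * K) <= q3 ->
  win N M (fun w => window_failure y kappa eta (B w) (S w) K i0 h N M) (q1 + (q2 + q3)).
Proof.
move=> NhM Hq1 Hq2 HPi Hq3.
have shift (F : nat -> R) c i : \sum_(c + i <= n < M) F (n - c)%N = \sum_(i <= n < M - c) F n.
  have [cM|Mc] := leqP c M; last first.
    have McI : (M <= c + i)%N by rewrite (leq_trans (ltnW Mc))// leq_addr.
    by rewrite !big_geq ?leq_subLR.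
  rewrite -{1}(subnKC cM) addnC [(c + _)%N]addnC big_addn addnK.
  by apply: eq_bigr => n _; rewrite addnK.
pose e k := \sum_(k + i0 <= n < M) a ^+ (n - k) +
  expR ((expR eta - 1) * Pi - eta * K).
have seqin (F : nat -> Omega -> R) (G : nat -> R) i j :
    (forall n, (i <= n < j)%N -> win N M (F n) (G n)) ->
    win N M (fun w => \sum_(i <= n < j) F n w) (\sum_(i <= n < j) G n).
  move=> H; rewrite big_nat; under eq_fun do rewrite big_nat.
  exact: (window_le_sum mx mv alpha_gt0).
have H1 : win N M (fun w => \sum_(N + h <= n < M) late y (S w) N n)
    (\sum_(N + h <= n < M) p (n - N)).
  apply: (seqin) => n /andP[Nn nM]; apply: win_late; rewrite nM andbT.
  by apply: leq_trans Nn; exact: leq_addr.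
have H2 : win N M (fun w => \sum_(N <= k < (N + h).+1)
     (\sum_(k + i0 <= n < M) fast y kappa (B w) k n + crowd y eta (S w) K i0 M k))
    (\sum_(N <= k < (N + h).+1) e k).
  apply: (seqin) => k /andP[Nk kN].
  have kM : (k <= M)%N by apply: leq_trans NhM.
  rewrite /e; apply: (window_leD mx mv alpha_gt0).
    apply: (seqin (fun n w => fast y kappa (B w) k n) (fun n => a ^+ (n - k))).
    move=> n /andP[kn nM]; apply: window_le_fast; last exact: ltnW.
    by rewrite Nk; apply: leq_trans kn; exact: leq_addr.
  apply: window_le_crowd; first by rewrite Nk.
  by rewrite (shift p).
have := window_leD mx mv alpha_gt0 H1 H2.
apply: (window_le_weaken alpha_gt0).
apply: lerD; first by rewrite (shift p).
apply: (@le_trans _ _ (\sum_(N <= k < (N + h).+1) (a ^+ i0 / (1 - a) +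
    expR ((expR eta - 1) * Pi - eta * K)))).
  apply: ler_sum => k _; rewrite lerD2r (shift (fun i => a ^+ i)).
  by apply: sum_geometric_le; case/andP: a_itv => /ltW -> ->.
rewrite sumr_const_nat.
rewrite -addnS addKn.
by rewrite -mulr_natl mulrDr lerD.
Qed.

Let win_survival c n : (c <= n)%N ->
  win 0 n.+1 (fun w => survival y kappa (B w) (S w) c n) (p (n - c) + a ^+ (n - c)).
Proof.
move=> cn; apply: (window_leD mx mv alpha_gt0); first by apply: win_late; rewrite /= ltnSn.
by apply: window_le_fast.
Qed.

(** The [k + 1] disjoint windows give the power of [pl], the remote terms are added one by one, and
    [window_le_arrivals] supplies the length factor in both cases. *)
Lemma stage_cost_int (T : nat -> nat) K i0 h k (pl : R) (rho : nat -> R) :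
  (forall j, (T j + h <= T j.+1)%N) ->
  (forall j, win (T j) (T j.+1) (fun w => window_failure y kappa eta (B w) (S w)
      K i0 h (T j) (T j.+1)) pl) ->
  (forall j m, \sum_(0 <= n < m) (p (T j.+1 + n - (T j + h)) +
     a ^+ (T j.+1 + n - (T j + h))) <= rho j) ->
  measurable_fun setT (fun w => stage_cost y kappa eta (B w) (S w) T K i0 h k) /\
  (\int[P]_w stage_cost y kappa eta (B w) (S w) T K i0 h k <=
   ((T (2 * k).+3)%:R * (xi / alpha) *
     (pl ^+ k.+1 + \sum_(k <= j < (2 * k).+1) rho j))%:E)%E.
Proof.
move=> Th Hpl Hrho.
pose Wn w : R := \sum_(0 <= i < T (2 * k).+3) B w i.
have W0 w : 0 <= Wn w by apply: sumr_ge0 => i _; exact: normr_ge0.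
have mW : measurable_fun setT Wn.
  by apply: measurable_sum => i; apply: measurableT_comp.
pose Ph j w := window_failure y kappa eta (B w) (S w) K i0 h (T j) (T j.+1).
pose prodPh w := \prod_(k <= j < (2 * k).+1) Ph j w.
pose sv j n w := survival y kappa (B w) (S w) (T j + h) (T j.+1 + n).
have winP : win (T k) (T (2 * k).+1) prodPh (\prod_(k <= j < (2 * k).+1) pl).
  apply: (window_le_prod mx mv alpha_gt0) => [j|]; first exact: Hpl.
  by lia.
have winP0 : win 0 (T (2 * k).+1) prodPh (pl ^+ k.+1).
  have -> : pl ^+ k.+1 = 1 * \prod_(k <= j < (2 * k).+1) pl.
    by rewrite mul1r prodr_const_nat; congr (_ ^+ _); lia.
  (* The constant 1 on [[0, T k)] extends the window down to index 0. *)
  have := window_le_trans (window_le_cst1 P kappa mx mv alpha_gt0 (leq0n (T k))) winP.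
  by congr window_le; apply/funext => w; rewrite mul1r.
have winS j n : win 0 (T j.+1 + n).+1 (sv j n)
    (p (T j.+1 + n - (T j + h)) + a ^+ (T j.+1 + n - (T j + h))).
  by apply: win_survival; apply: leq_trans (Th j) _; exact: leq_addr.
have msv j n : measurable_fun setT (sv j n) by have [] := winS j n.
have sv0 j n w : 0 <= sv j n w by exact: survival_ge0.
have mP : measurable_fun setT prodPh by have [] := winP0.
have P0 w : 0 <= prodPh w by have [_ +] := winP0; exact.
have E w : stage_cost y kappa eta (B w) (S w) T K i0 h k =
    ((Wn w * prodPh w)%:E + \sum_(k <= j < (2 * k).+1)
      \sum_(0 <= n <oo) (Wn w * sv j n w)%:E)%E.
  rewrite /stage_cost ge0_muleDr; last 2 first.
  - by rewrite lee_fin; exact: P0.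
  - by apply: sume_ge0 => j _; exact: remote_failure_ge0.
  rewrite -EFinM; congr (_ + _)%E.
  rewrite ge0_sume_distrr; last by move=> j _; exact: remote_failure_ge0.
  apply: eq_bigr => j _; rewrite /remote_failure.
  rewrite -nneseriesZl// => n _.
  by rewrite lee_fin; exact: survival_ge0.
have mS j : measurable_fun setT (fun w => \sum_(0 <= n <oo) (Wn w * sv j n w)%:E)%E.
  apply: ge0_emeasurable_sum => n *; first by rewrite lee_fin mulr_ge0.
  by apply/measurable_EFinP; exact: measurable_funM.
have S0 j w : (0 <= \sum_(0 <= n <oo) (Wn w * sv j n w)%:E)%E.
  by apply: nneseries_ge0 => n _ _; rewrite lee_fin mulr_ge0.
have mWP : measurable_fun setT (fun w => (Wn w * prodPh w)%:E).
  by apply/measurable_EFinP; exact: measurable_funM.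
under eq_fun do rewrite E; split.
  apply: emeasurable_funD => //.
  by apply: emeasurable_sum => j.
rewrite ge0_integralD//; last 3 first.
- by move=> w _; rewrite lee_fin mulr_ge0.
- by move=> w _; apply: sume_ge0.
- exact: emeasurable_sum.
rewrite mulrDr EFinD; apply: leeD.
  exact: (window_le_arrivals mx mv indep_xv alpha_gt0 alpha_le1 kappa_ge0
    x_laplace x_mean _ winP0).
rewrite ge0_integral_sum// mulr_sumr -sumEFin; apply: lee_sum => j _.
apply: (@integral_nneseries_le _ _ _ P _ (fun n => (T (2 * k).+3)%:R * (xi / alpha) *
  (p (T j.+1 + n - (T j + h)) + a ^+ (T j.+1 + n - (T j + h))))).
- by move=> n; apply/measurable_EFinP; exact: measurable_funM.
- by move=> n w; rewrite lee_fin mulr_ge0.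
- move=> n; exact: (window_le_arrivals mx mv indep_xv alpha_gt0 alpha_le1 kappa_ge0
    x_laplace x_mean _ (winS j n)).
move=> m; rewrite -mulr_sumr ler_wpM2l// mulr_ge0 ?divr_ge0 ?(ltW alpha_gt0)//.
rewrite -lee_fin; apply: le_trans (x_mean 0%N).
by apply: integral_ge0 => w _; rewrite lee_fin.
Qed.

Lemma excess_int (b EV c : R) (r : nat -> R) : 0 <= b ->
  (\int[P]_w (`|V w|)%:E <= EV%:E)%E ->
  (forall n, (\int[P]_w (`|V w| * (b < V w)%R%:R * (y n < V w)%R%:R)%:E <= (r n)%:E)%E) ->
  (forall m, \sum_(0 <= n < m) (r n + a ^+ n * EV) <= c) ->
  measurable_fun setT (fun w => excess y kappa (B w) (S w) b) /\
  (\int[P]_w excess y kappa (B w) (S w) b <= (b + c)%:E)%E.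
Proof.
move=> b0 HEV Hr Hc.
have EV0 : 0 <= EV.
  rewrite -lee_fin; apply: le_trans HEV.
  by apply: integral_ge0 => w _; rewrite lee_fin.
have mabs : measurable_fun setT (fun z : R => `|z|) by exact: normr_measurable.
pose F n w := `|S w n| * (b < S w n)%R%:R * survival y kappa (B w) (S w) 0 n.
have F0 n w : 0 <= F n w by rewrite !mulr_ge0// survival_ge0.
have winF n : win 0 n.+1 (F n) (r n + a ^+ n * EV).
  have H1 : win 0 n.+1 (fun w => `|S w n| * (b < S w n)%R%:R * late y (S w) 0 n) (r n).
    apply: (@window_le_service 0 n.+1 n
      (fun z => `|z| * (b < z)%R%:R * (y (n - 0)%N < z)%R%:R)).
    - by rewrite /= ltnSn.
    - apply: measurable_funM; last exact: measurable_gt_indic.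
      by apply: measurable_funM => //; exact: measurable_gt_indic.
    - by move=> z; rewrite !mulr_ge0.
    - by rewrite subn0.
  (* [fast 0 n] involves only interarrival times of index below [n], so it and the service of [-n]
     live on the consecutive windows [[0, n)] and [[n, n + 1)]. *)
  have H2 : win 0 n.+1 (fun w => fast y kappa (B w) 0 n * (`|S w n| * (b < S w n)%R%:R))
      (a ^+ n * EV).
    apply: (@window_le_trans _ _ _ P x v kappa alpha 0 n).
      have Hf : win 0 n (fun w => fast y kappa (B w) 0 n) (a ^+ (n - 0)).
        exact: window_le_fast.
      by rewrite subn0 in Hf; exact: Hf.
    apply: (@window_le_service n n.+1 n (fun z => `|z| * (b < z)%R%:R)).
    - by rewrite leqnn ltnSn.
    - by apply: measurable_funM => //; exact: measurable_gt_indic.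
    - by move=> z; rewrite mulr_ge0.
    apply: le_trans HEV; apply: ge0_le_integral => //.
    - apply/measurable_EFinP; apply: measurable_funM; first exact: measurableT_comp.
      exact: (measurableT_comp (measurable_gt_indic b)).
    - by apply/measurable_EFinP; exact: measurableT_comp.
    - by move=> w _; rewrite lee_fin ler_piMr//; case: (_ < _).
  have := window_leD mx mv alpha_gt0 H1 H2; congr window_le.
  by apply/funext => w; rewrite /F /survival mulrDr; congr (_ + _); rewrite mulrC.
have mF n : measurable_fun setT (fun w => (F n w)%:E).
  by apply/measurable_EFinP; have [] := winF n.
have mS : measurable_fun setT (fun w => \sum_(0 <= n <oo) (F n w)%:E)%E.
  by apply: ge0_emeasurable_sum => n *; [rewrite lee_fin|exact: mF].
split; first exact: emeasurable_funD.
rewrite /excess ge0_integralD//; last first.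
  by move=> w _; apply: nneseries_ge0 => n _ _; rewrite lee_fin; exact: F0.
rewrite EFinD; apply: leeD.
  by rewrite integral_cst//= probability_setT mule1.
apply: (@integral_nneseries_le _ _ _ P _ (fun n => r n + a ^+ n * EV)) => //.
move=> n; exact: (window_le_int mx mv indep_xv x_laplace (winF n)).
Qed.

Lemma majorant_int (T : nat -> nat) K i0 h (pl : R) (rho : nat -> R)
    (b EV cG cS : R) (r : nat -> R) :
  (forall j, (T j + h <= T j.+1)%N) ->
  (forall j, win (T j) (T j.+1) (fun w => window_failure y kappa eta (B w) (S w)
      K i0 h (T j) (T j.+1)) pl) ->
  (forall j m, \sum_(0 <= n < m) (p (T j.+1 + n - (T j + h)) +
     a ^+ (T j.+1 + n - (T j + h))) <= rho j) ->
  (forall m, \sum_(0 <= k < m) ((T (2 * k).+3)%:R * (xi / alpha) *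
     (pl ^+ k.+1 + \sum_(k <= j < (2 * k).+1) rho j)) <= cS) ->
  0 <= b ->
  (\int[P]_w (`|V w|)%:E <= EV%:E)%E ->
  (forall n, (\int[P]_w (`|V w| * (b < V w)%R%:R * (y n < V w)%R%:R)%:E <= (r n)%:E)%E) ->
  (forall m, \sum_(0 <= n < m) (r n + a ^+ n * EV) <= cG) ->
  let M w := (excess y kappa (B w) (S w) b + (\sum_(0 <= i < T 1) B w i)%:E +
    \sum_(0 <= k <oo) stage_cost y kappa eta (B w) (S w) T K i0 h k)%E in
  [/\ measurable_fun setT M, forall w, (0 <= M w)%E &
    (\int[P]_w M w <= (b + cG + (T 1)%:R * (xi / alpha) + cS)%:E)%E].
Proof.
move=> Th Hpl Hrho HS b0 HEV Hr Hc M.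
have [mE iE] := excess_int b0 HEV Hr Hc.
have E0 w : (0 <= excess y kappa (B w) (S w) b)%E by exact: excess_ge0.
have B0 w i : 0 <= B w i by exact: normr_ge0.
have SC k := stage_cost_int k Th Hpl Hrho.
have SC0 k w : (0 <= stage_cost y kappa eta (B w) (S w) T K i0 h k)%E.
  exact: stage_cost_ge0.
have mA : measurable_fun setT (fun w => (\sum_(0 <= i < T 1) B w i)%:E).
  apply/measurable_EFinP.
  by apply: measurable_sum => i; apply: measurableT_comp.
have mSC : measurable_fun setT (fun w =>
    \sum_(0 <= k <oo) stage_cost y kappa eta (B w) (S w) T K i0 h k)%E.
  by apply: ge0_emeasurable_sum => k *; [exact: SC0|exact: (SC k).1].
have A0 w : (0 <= (\sum_(0 <= i < T 1) B w i)%:E)%E by rewrite lee_fin sumr_ge0.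
have S0 w : (0 <= \sum_(0 <= k <oo) stage_cost y kappa eta (B w) (S w) T K i0 h k)%E.
  by apply: nneseries_ge0 => n _ _.
have mEA : measurable_fun setT (fun w => excess y kappa (B w) (S w) b +
    (\sum_(0 <= i < T 1) B w i)%:E)%E by exact: emeasurable_funD.
split; [exact: emeasurable_funD|by move=> w; apply: adde_ge0 => //; apply: adde_ge0|].
rewrite /M ge0_integralD//; last by move=> w _; rewrite adde_ge0.
rewrite ge0_integralD//.
rewrite !EFinD -EFinD; apply: leeD; last first.
  by apply: (integral_nneseries_le _ _ (fun k => (SC k).2)) => // k; exact: (SC k).1.
apply: leeD => //.
have := window_le_arrivals mx mv indep_xv alpha_gt0 alpha_le1 kappa_ge0
  x_laplace x_mean (T 1) (window_le_cst1 P kappa mx mv alpha_gt0 (leqnn 0)).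
by rewrite mulr1; congr (_ <= _)%E; apply: eq_integral => w _; rewrite /= mulr1.
Qed.

End stage_expectation.

(** * Moments and the stationary system *)

Section moments.
Context {d : measure_display} {Omega : measurableType d} {R : realType}.
Variable P : probability Omega R.
Import HBNNSimple.

(** A bounded simple function below [|X|] still has mean [m > c]. For it the expansion
    [exp (- u) <= 1 - u + u^2] can be integrated, and the linear gain beats the quadratic term for
    small [theta]. *)
Lemma laplace_below_mean (X : Omega -> R) (c : R) : measurable_fun setT X ->
  0 <= c -> (c%:E < \int[P]_w (`|X w|)%:E)%E ->
  exists theta alpha : R, [/\ 0 < theta, 0 < alpha <= 1, expR (theta * c) * alpha < 1 &
    (\int[P]_w (expR (- (theta * `|X w|)))%:E <= alpha%:E)%E].
Proof.
move=> mX c0; rewrite ge0_integralTE; last by move=> w; rewrite lee_fin.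
move=> /ereal_sup_gt[_ [h /= hX <-]].
have -> : sintegral P h = (\int[P]_w (h w)%:E)%E.
  by rewrite integral_nnsfun// patch_setT.
move=> ch.
have [K K0 hK] : exists2 K : R, 0 < K & forall w, h w <= K.
  have [K [_ HK]] := simple_bounded h.
  exists (`|K| + 1) => [|w]; first by rewrite ltr_pwDr.
  apply: le_trans (ler_norm _) _; apply: (HK (`|K| + 1)) => //.
  by rewrite ltr_pwDr// ler_norm.
have mh : measurable_fun setT (fun w => (h w)%:E) by exact/measurable_EFinP.
have hfin : (\int[P]_w (h w)%:E)%E \is a fin_num.
  rewrite ge0_fin_numE; last by apply: integral_ge0 => w _; rewrite lee_fin.
  apply: (@le_lt_trans _ _ (\int[P]_w K%:E)%E).
    by apply: ge0_le_integral => //= w _; rewrite lee_fin.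
  by rewrite integral_cst//= probability_setT mule1 ltry.
pose m := fine (\int[P]_w (h w)%:E)%E.
have mE : (\int[P]_w (h w)%:E)%E = m%:E by rewrite /m fineK.
have cm : c < m by rewrite -lte_fin -mE.
(* Then [theta K^2 = (m - c) / 2], so that the exponent [z] below satisfies
   [z + theta c = - theta (m - c) / 2 < 0]. *)
pose theta := (m - c) / (2 * K ^+ 2).
have K2 : 0 < K ^+ 2 by rewrite exprn_gt0.
have t0 : 0 < theta by rewrite divr_gt0 ?subr_gt0 ?mulr_gt0.
have tK : theta * K ^+ 2 = (m - c) / 2.
  by rewrite /theta; field; rewrite gt_eqF.
pose z := theta * (theta * K ^+ 2 - m).
have z0 : z <= 0.
  by rewrite /z tK pmulr_rle0//; lra.
exists theta, (expR z); split => //.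
- by rewrite expR_gt0/= -expR0 ler_expR.
- rewrite -expRD -expR0 ltr_expR /z tK -mulrDr pmulr_rlt0//; lra.
have mexp : measurable_fun setT (fun w => (expR (- (theta * h w)))%:E).
  apply/measurable_EFinP; apply: measurableT_comp => //.
  by apply: measurableT_comp => //; apply: measurable_funM.
apply: (@le_trans _ _ (\int[P]_w (expR (- (theta * h w)))%:E)%E).
  apply: ge0_le_integral => //=.
  - apply/measurable_EFinP; apply: measurableT_comp => //.
    apply: measurableT_comp => //; apply: measurable_funM => //.
    exact: measurableT_comp.
  - move=> w _; rewrite lee_fin ler_expR lerN2 ler_pM2l//.
    by rewrite -lee_fin.
have mth : measurable_fun setT (fun w => (theta * h w)%:E).
  by apply/measurable_EFinP; apply: measurable_funM.
have key : (\int[P]_w (expR (- (theta * h w)))%:E + (theta * m)%:E <=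
    (1 + theta ^+ 2 * K ^+ 2)%:E)%E.
  have -> : ((theta * m)%:E = \int[P]_w (theta * h w)%:E)%E.
    under eq_integral do rewrite EFinM.
    rewrite ge0_integralZl// ?mE//; last by rewrite lee_fin ltW.
    by move=> w _; rewrite lee_fin.
  rewrite -ge0_integralD//; last by move=> w _; rewrite lee_fin mulr_ge0// ltW.
  apply: (@le_trans _ _ (\int[P]_w (1 + theta ^+ 2 * K ^+ 2)%:E)%E); last first.
    by rewrite integral_cst//= probability_setT mule1.
  apply: ge0_le_integral => //=.
  - by move=> w _; rewrite adde_ge0// lee_fin ?expR_ge0// mulr_ge0// ltW.
  - exact: emeasurable_funD.
  move=> w _; rewrite -EFinD lee_fin.
  set u := theta * h w; have u0 : 0 <= u by rewrite mulr_ge0// ltW.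
  have uK : u ^+ 2 <= theta ^+ 2 * K ^+ 2.
    have uK : u <= theta * K by rewrite /u ler_wpM2l ?(ltW t0).
    by rewrite -exprMn; apply: lerXn2r => //; rewrite nnegrE (le_trans u0).
  have e1 : expR (- u) <= (1 + u)^-1.
    by rewrite expRN lef_pV2 ?posrE ?expR_gt0 ?expR_ge1Dx//; lra.
  have u1 : (1 + u)^-1 <= 1 - u + u ^+ 2.
    have u1 : 0 < 1 + u by lra.
    rewrite -[leLHS]mul1r ler_pdivrMr//.
    have -> : (1 - u + u ^+ 2) * (1 + u) = 1 + u ^+ 3 by ring.
    by rewrite lerDl exprn_ge0.
  lra.
have -> : ((expR z)%:E = ((expR z + theta * m)%:E - (theta * m)%:E))%E.
  by rewrite -EFinB addrK.
rewrite leeBrDr//; apply: le_trans key _.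
rewrite lee_fin; have := expR_ge1Dx z.
have -> : z = theta ^+ 2 * K ^+ 2 - theta * m by rewrite /z; ring.
lra.
Qed.

Variable V : Omega -> R.
Hypothesis mV : measurable_fun setT V.
Hypothesis V0 : forall w, 0 <= V w.
Hypothesis V_moment : forall q : R, 0 < q ->
  (\int[P]_w (V w `^ q)%:E < +oo)%E.

Let m1V q : measurable_fun setT (fun w => ((1 + V w) ^+ q)%:E).
Proof.
apply/measurable_EFinP; apply: measurable_funX.
exact: measurable_funD.
Qed.

Let V1 w : 0 <= 1 + V w. Proof. by rewrite addr_ge0. Qed.

(** [(1 + V)^q <= (1 + V)^(q+1) <= 2^(q+1) (1 + V^(q+1))]; passing to [q + 1] provides a positive
    exponent for [V_moment]. *)
Lemma moment_1p (q : nat) : exists2 M : R, 0 <= M &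
  (\int[P]_w ((1 + V w) ^+ q)%:E <= M%:E)%E.
Proof.
have q0 : 0 < q.+1%:R :> R by [].
have mVq : measurable_fun setT (fun w => (V w ^+ q.+1)%:E).
  by apply/measurable_EFinP; exact: measurable_funX.
have fin : (\int[P]_w (V w ^+ q.+1)%:E)%E \is a fin_num.
  rewrite ge0_fin_numE; last first.
    by apply: integral_ge0 => w _; rewrite lee_fin exprn_ge0.
  have := V_moment q0; congr (_ < _)%E; apply: eq_integral => w _.
  by rewrite powR_mulrn.
exists (2 ^+ q.+1 * (1 + fine (\int[P]_w (V w ^+ q.+1)%:E)%E)).
  rewrite mulr_ge0 ?exprn_ge0// addr_ge0// fine_ge0//.
  by apply: integral_ge0 => w _; rewrite lee_fin exprn_ge0.
rewrite EFinM EFinD fineK//.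
have -> : (1%:E + \int[P]_w (V w ^+ q.+1)%:E = \int[P]_w (1%:E + (V w ^+ q.+1)%:E))%E.
  rewrite ge0_integralD//; last first.
    by move=> w _; rewrite lee_fin exprn_ge0.
  by rewrite integral_cst//= probability_setT mule1.
rewrite -ge0_integralZl//; last 2 first.
- exact: emeasurable_funD.
- by move=> w _; rewrite -EFinD lee_fin addr_ge0// exprn_ge0.
apply: ge0_le_integral => //=.
- by move=> w _; rewrite lee_fin exprn_ge0.
- by apply: measurable_funeM; exact: emeasurable_funD.
move=> w _; rewrite -EFinD -EFinM lee_fin.
apply: (@le_trans _ _ ((1 + V w) ^+ q.+1)).
  by rewrite exprS ler_peMl ?exprn_ge0// lerDl.
have [V1w|V1w] := leP (V w) 1.
  apply: (@le_trans _ _ (2 ^+ q.+1)).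
    by rewrite lerXn2r ?nnegrE//; have := V0 w; lra.
  by rewrite ler_peMr ?exprn_ge0// lerDl exprn_ge0.
apply: (@le_trans _ _ ((2 * V w) ^+ q.+1)).
  by rewrite lerXn2r ?nnegrE ?mulr_ge0//; lra.
by rewrite exprMn ler_pM2l ?exprn_gt0// lerDr.
Qed.

Let mlt (z : R) : measurable_fun setT (fun w => ((z < V w)%R%:R : R)).
Proof. exact: (measurableT_comp (measurable_gt_indic z)). Qed.

Variables (c1 s : R).
Hypothesis c1_gt0 : 0 < c1.
Hypothesis s_ge1 : 1 <= s.

Let nominal (i : nat) : R := c1 * i%:R / s.

Let s_gt0 : 0 < s. Proof. exact: lt_le_trans s_ge1. Qed.

(** The base of the Markov bounds. The shifted lag [i + 1] avoids a division by zero, and [1 + V]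
    absorbs the shift. *)
Let beyond w i : nominal i < V w ->
  1 <= (1 + c1^-1) * (1 + V w) * (s / i.+1%:R).
Proof.
rewrite /nominal ltr_pdivrMr// mulrC -ltr_pdivlMr// => H.
rewrite mulrA ler_pdivlMr// mul1r -natr1.
have ci : 0 < c1^-1 by rewrite invr_gt0.
have -> : (1 + c1^-1) * (1 + V w) * s =
  V w * s / c1 + s + (c1^-1 * s + V w * s) by ring.
rewrite -[leLHS]addr0; apply: lerD.
  by apply: lerD => //; exact: ltW.
by rewrite addr_ge0// mulr_ge0// ltW.
Qed.

Lemma tail_moment (q : nat) (M : R) (i : nat) :
  (\int[P]_w ((1 + V w) ^+ q)%:E <= M%:E)%E ->
  (\int[P]_w ((nominal i < V w)%R%:R : R)%:E <=
   ((1 + c1^-1) ^+ q * M * (s / i.+1%:R) ^+ q)%:E)%E.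
Proof.
move=> HM; pose k := (1 + c1^-1) ^+ q * (s / i.+1%:R) ^+ q.
have ci : 0 < c1^-1 by rewrite invr_gt0.
have k0 : 0 <= k.
  by rewrite mulr_ge0 ?exprn_ge0// ?divr_ge0 ?(ltW s_gt0)//; lra.
have -> : (1 + c1^-1) ^+ q * M * (s / i.+1%:R) ^+ q = k * M by rewrite /k; ring.
apply: (@le_trans _ _ (k%:E * \int[P]_w ((1 + V w) ^+ q)%:E)%E); last first.
  by rewrite [leRHS]EFinM; apply: lee_wpmul2l => //; rewrite lee_fin.
rewrite -ge0_integralZl//; last by move=> w _; rewrite lee_fin exprn_ge0.
apply: ge0_le_integral => //=.
- exact/measurable_EFinP.
- exact: measurable_funeM.
move=> w _; rewrite -EFinM lee_fin; case: ltP => H /=; last first.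
  by rewrite mulr_ge0// exprn_ge0.
have -> : k * (1 + V w) ^+ q = ((1 + c1^-1) * (1 + V w) * (s / i.+1%:R)) ^+ q.
  by rewrite /k !exprMn; ring.
by rewrite exprn_ege1// beyond.
Qed.

(** Of the [r + 3] powers of [1 + V], one bounds the service itself, [r] yield [b^-r], and two yield
    a summable function of the lag. *)
Lemma excess_moment (r : nat) (b M : R) (i : nat) : 0 < b ->
  (\int[P]_w ((1 + V w) ^+ r.+3)%:E <= M%:E)%E ->
  (\int[P]_w (`|V w| * (b < V w)%R%:R * (nominal i < V w)%R%:R)%:E <=
   ((1 + c1^-1) ^+ 2 * M * b^-1 ^+ r * (s / i.+1%:R) ^+ 2)%:E)%E.
Proof.
move=> b0 HM; pose k := (1 + c1^-1) ^+ 2 * b^-1 ^+ r * (s / i.+1%:R) ^+ 2.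
have ci : 0 < c1^-1 by rewrite invr_gt0.
have bi : 0 < b^-1 by rewrite invr_gt0.
have k0 : 0 <= k.
  by rewrite !mulr_ge0 ?exprn_ge0// ?divr_ge0 ?(ltW s_gt0) ?(ltW bi)//; lra.
have -> : (1 + c1^-1) ^+ 2 * M * b^-1 ^+ r * (s / i.+1%:R) ^+ 2 = k * M by rewrite /k; ring.
apply: (@le_trans _ _ (k%:E * \int[P]_w ((1 + V w) ^+ r.+3)%:E)%E); last first.
  by rewrite [leRHS]EFinM; apply: lee_wpmul2l => //; rewrite lee_fin.
rewrite -ge0_integralZl//; last by move=> w _; rewrite lee_fin exprn_ge0.
apply: ge0_le_integral => //=.
- apply/measurable_EFinP; apply: measurable_funM => //; apply: measurable_funM => //.
  exact: measurableT_comp.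
- exact: measurable_funeM.
move=> w _; rewrite -EFinM lee_fin (ger0_norm (V0 w)).
have rhs0 : 0 <= k * (1 + V w) ^+ r.+3 by rewrite mulr_ge0// exprn_ge0.
case: (ltP b (V w)) => bV; last by rewrite mulr0 mul0r.
case: (ltP (nominal i) (V w)) => nV; last by rewrite mulr0.
rewrite !mulr1.
have -> : k * (1 + V w) ^+ r.+3 = (1 + V w) * ((1 + V w) / b) ^+ r *
    ((1 + c1^-1) * (1 + V w) * (s / i.+1%:R)) ^+ 2.
  by rewrite /k !exprMn !exprS; ring.
apply: (@le_trans _ _ (1 + V w)); first by rewrite lerDr.
rewrite -[leLHS]mulr1; apply: ler_pM => //.
  rewrite -[leLHS]mulr1 ler_wpM2l// exprn_ege1// ler_pdivlMr// mul1r.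
  by apply: le_trans (ltW bV) _; rewrite lerDr.
by rewrite exprn_ege1// beyond.
Qed.

(** A discrete layer-cake formula: at most [s V / c1] integers [i >= 1] satisfy [c1 i / s < V]. The
    index 0 could add one more, hence [0 < i0]. *)
Lemma sum_tail_le (EV : R) (p : nat -> R) (i0 m : nat) : (0 < i0)%N ->
  (\int[P]_w (V w)%:E <= EV%:E)%E ->
  (forall i, (\int[P]_w ((nominal i < V w)%R%:R : R)%:E = (p i)%:E)%E) ->
  \sum_(i0 <= i < m) p i <= s / c1 * EV.
Proof.
move=> i00 HEV Hp.
have p0 i : 0 <= p i.
  by rewrite -lee_fin -Hp; apply: integral_ge0 => w _; rewrite lee_fin.
have sc : 0 < s / c1 by rewrite divr_gt0.
apply: (@le_trans _ _ (\sum_(1 <= i < m) p i)).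
  have [im|mi] := leqP i0 m; last by rewrite big_geq 1?ltnW// sumr_ge0.
  by rewrite [leRHS](big_cat_nat i00 im)/= lerDr sumr_ge0.
rewrite -lee_fin -sumEFin.
under eq_bigr do rewrite -Hp.
rewrite -ge0_integral_sum//; last by move=> i; exact/measurable_EFinP.
apply: (@le_trans _ _ ((s / c1)%:E * \int[P]_w (V w)%:E)%E); last first.
  by rewrite [leRHS]EFinM; apply: lee_wpmul2l => //; rewrite lee_fin ltW.
rewrite -ge0_integralZl//; last 3 first.
- exact/measurable_EFinP.
- by move=> w _; rewrite lee_fin.
- by rewrite lee_fin ltW.
apply: ge0_le_integral => //=.
- by move=> w _; apply: sume_ge0 => i _; rewrite lee_fin.
- by apply: emeasurable_sum => i; exact/measurable_EFinP.
- by apply: measurable_funeM; exact/measurable_EFinP.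
move=> w _; rewrite sumEFin -EFinM lee_fin.
apply: le_trans (@count_below_le R (s / c1 * V w) m _); last by rewrite mulr_ge0// ltW.
apply: ler_sum => i _; rewrite ler_nat /nominal ltr_pdivrMr//.
by rewrite [s / c1 * _]mulrAC ltr_pdivlMr// [i%:R * _]mulrC [s * _]mulrC.
Qed.

End moments.

Section stationary_facts.
Context {d : measure_display} {Omega : measurableType d} {R : realType}.
Variables (P : probability Omega R) (X1 V1 : Omega -> R).
Hypothesis mX1 : measurable_fun setT X1.
Hypothesis mV1 : measurable_fun setT V1.
Hypothesis X1_fin : ('E_P[X1] < +oo)%E.
Hypothesis X1_pos : P [set w | X1 w <= 0] = 0%E.
Hypothesis V1_ge0 : forall w, 0 <= V1 w.

Lemma ae_X1_gt0 : {ae P, forall w, 0 < X1 w}.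
Proof.
exists [set w | X1 w <= 0]; split => //.
- have -> : [set w | X1 w <= 0] = X1 @^-1` `]-oo, 0%R]%classic.
    by apply/seteqP; split => w /=; rewrite in_itv.
  by rewrite -[X in measurable X]setTI; exact: mX1.
- by move=> w /= /negP; rewrite -leNgt.
Qed.

Let mabs : measurable_fun setT (fun w => (`|X1 w|)%:E).
Proof. by apply/measurable_EFinP; exact: measurableT_comp. Qed.

Lemma mean_abs_X1 : ('E_P[X1] = \int[P]_w (`|X1 w|)%:E)%E.
Proof.
rewrite unlock; apply: ae_eq_integral => //; first exact/measurable_EFinP.
by apply: filterS ae_X1_gt0 => w w0 _ /=; rewrite gtr0_norm.
Qed.

Lemma mean_X1_fin : ('E_P[X1] = (fine 'E_P[X1])%:E)%E.
Proof.
rewrite fineK// ge0_fin_numE// mean_abs_X1.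
by apply: integral_ge0 => w _; rewrite lee_fin.
Qed.

Lemma mean_X1_gt0 : 0 < fine 'E_P[X1].
Proof.
rewrite -lte_fin -mean_X1_fin mean_abs_X1 lt0e; apply/andP; split; last first.
  by apply: integral_ge0 => w _; rewrite lee_fin.
apply/negP => /eqP E0.
have mX : measurable_fun setT (fun w => (X1 w)%:E) by exact/measurable_EFinP.
have [/(_ E0) X0 _] := ae_eq_integral_abs P measurableT mX.
have [N [mN N0 NP]] : {ae P, forall w, False}.
  apply: filterS2 ae_X1_gt0 X0 => w + /(_ Logic.I) [] E.
  by rewrite E ltxx.
have : P setT = 0%E.
  apply/eqP; rewrite -measure_le0 -N0; apply: le_measure; rewrite ?inE//.
  by move=> w _; apply: NP => -[].
by rewrite probability_setT => /eqP; rewrite onee_eq0.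
Qed.

Variables (s : nat) (L U : Omega -> R) (Fw Bw : nat -> Omega -> R)
  (Sv : int -> Omega -> R).
Hypothesis s_gt0 : (0 < s)%N.
Hypothesis sys : stationary_system P X1 V1 s L U Fw Bw Sv.

Let sR : 0 < s%:R :> R. Proof. by rewrite ltr0n. Qed.

Let mXs : measurable_fun setT (fun w => X1 w / s%:R).
Proof. exact: measurable_funM. Qed.

Let mitv (Y : Omega -> R) (i : interval R) : measurable_fun setT Y ->
  measurable (Y @^-1` [set` i]).
Proof. by move=> mY; rewrite -[X in measurable X]setTI; exact: mY. Qed.

Lemma stationary_measurable : (forall k, measurable_fun setT (Bw k)) /\
  (forall k, measurable_fun setT (Sv (back_index k))).
Proof. by case: sys => [[_ [_ [_ [? ?]]]] _ _]. Qed.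

Lemma stationary_service_law i (g : R -> R) : measurable_fun setT g ->
  (forall z, 0 <= g z) ->
  (\int[P]_w (g (Sv (back_index i) w))%:E = \int[P]_w (g (V1 w))%:E)%E.
Proof.
case: sys => [[_ [_ [_ [_ mSv]]]] [_ [_ [_ [_ lawS]]]] _] mg g0.
exact: integral_same_law.
Qed.

Lemma stationary_arrival_law i (g : R -> R) : measurable_fun setT g ->
  (forall z, 0 <= g z) ->
  (\int[P]_w (g (Bw i w))%:E = \int[P]_w (g (X1 w / s%:R))%:E)%E.
Proof.
case: sys => [[_ [_ [_ [mB _]]]] [_ [_ [_ [lawB _]]]] _] mg g0.
exact: integral_same_law.
Qed.

Lemma stationary_indep (m : nat) (A B : nat -> set R) :
  (forall i, measurable (A i)) -> (forall i, measurable (B i)) ->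
  P (\bigcap_(i in `I_m) (Bw i @^-1` A i) `&`
     \bigcap_(i in `I_m) (Sv (back_index i) @^-1` B i)) =
  (\prod_(i < m) P (Bw i @^-1` A i) *
   \prod_(i < m) P (Sv (back_index i) @^-1` B i))%E.
Proof.
move=> mA mB; case: sys => _ _ indep.
case: m => [|m].
  rewrite !big_ord0 mule1 -(@probability_setT _ _ _ P); congr (P _).
  by apply/seteqP; split=> w // _; split.
(* The product formula has [m + 1] services of each sign. The past customers use [Posz 0] and the
   first [m] negative indices; the others receive [setT]. *)
pose BS (n : int) : set R := match n with
  | Posz 0 => B 0%N | Posz _ => setT
  | Negz k => if (k < m)%N then B k.+1 else setT end.
have mBS n : measurable (BS n) by case: n => [[|n]|k] //=; case: ifP.
have := indep m.+1 setT setT (fun=> setT) A BS measurableT measurableT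
  (fun=> measurableT) mA mBS.
have setTE : P setT = 1%E by exact: probability_setT.
rewrite !preimage_setT setTE !mul1e.
rewrite [X in (X * _ * _ * _)%E]big1//= mul1e.
rewrite [X in (_ * X * _)%E]big_ord_recl/= [X in (_ * (_ * X) * _)%E]big1 ?mule1; last first.
  by move=> i _; rewrite preimage_setT.
rewrite [X in (_ * X)%E]big_ord_recr/= ltnn preimage_setT setTE mule1 => H.
rewrite [X in (_ * X)%E]big_ord_recl/= muleA.
transitivity (\prod_(i < m.+1) P (Bw i @^-1` A i) * P (Sv (Posz 0) @^-1` B 0%N) *
    \prod_(i < m) P (Sv (Negz i) @^-1` (if (i < m)%N then B i.+1 else setT)))%E.
  rewrite -H; congr (P _); apply/seteqP; split=> w /=.
    move=> [hA hB]; do ![split] => //.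
    - by move=> [|i] im //=; exact: (hB 0%N).
    - by move=> i im; rewrite /= /BS; case: ifP => // im'; exact: (hB i.+1).
  move=> [[[_ hA] hP] hN]; split=> // -[|i] im; first exact: (hP 0%N).
  by have := hN i (ltnW im); rewrite /= /BS -ltnS im.
by congr (_ * _)%E; apply: eq_bigr => i _; rewrite ltn_ord.
Qed.

Lemma stationary_ae : {ae P, forall w, [/\ 0 <= U w * L w, 0 <= (1 - U w) * L w,
  forall k, 0 <= Fw k w, forall k, 0 < Bw k w & forall k, 0 <= Sv (back_index k) w]}.
Proof.
have [[mL [mU [mF [mB mS]]]] [lawL [lawU [lawF [lawB lawS]]]] _] := sys.
have Xle0 : P ((fun w => X1 w / s%:R) @^-1` `]-oo, 0%R]%classic) = 0%E.
  rewrite -X1_pos; congr (P _); apply/seteqP.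
  by split => w /=; rewrite in_itv/= ler_pdivrMr// mul0r.
have aB : {ae P, forall w, forall k, 0 < Bw k w}.
  apply: ae_foralln => k; exists (Bw k @^-1` `]-oo, 0%R]%classic); split.
  - exact: mitv.
  - by apply: etrans Xle0; apply: lawB.
  - by move=> w /= /negP; rewrite -leNgt in_itv.
have aF : {ae P, forall w, forall k, 0 <= Fw k w}.
  apply: ae_foralln => k; exists (Fw k @^-1` `]-oo, 0%R]%classic); split.
  - exact: mitv.
  - by apply: etrans Xle0; apply: lawF.
  - by move=> w /= /negP; rewrite -ltNge in_itv/=; exact: ltW.
have aS : {ae P, forall w, forall k, 0 <= Sv (back_index k) w}.
  apply: ae_foralln => k; exists (Sv (back_index k) @^-1` `]-oo, 0%R[%classic); split.
  - exact: mitv.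
  - apply: etrans (lawS _ _ (measurable_itv _)) _.
    rewrite (_ : V1 @^-1` _ = set0) ?measure0//.
    by rewrite -subset0 => w /=; rewrite in_itv/= ltNge V1_ge0.
  - by move=> w /= /negP; rewrite -ltNge in_itv.
have aU : {ae P, forall w, 0 <= U w <= 1}.
  exists (U @^-1` (~` `[0%R, 1%R]%classic)); split.
  - by rewrite preimage_setC; apply: measurableC; exact: mitv.
  - apply: etrans (lawU _ (measurableC (measurable_itv _))) _.
    by rewrite setICl measure0.
  - by move=> w /= H; rewrite in_itv.
(* Length biasing gives [P (L < 0) * E X1 / s = 0], because [X1] is almost surely positive; the mean
   is nonzero. *)
have aL : {ae P, forall w, 0 <= L w}.
  exists (L @^-1` `]-oo, 0%R[%classic); split; first exact: mitv.
  - have mneg : measurable ((fun w => X1 w / s%:R) @^-1` `]-oo, 0%R[%classic).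
      exact: mitv.
    have := lawL _ (measurable_itv `]-oo, 0%R[).
    rewrite null_set_integral//; last 2 first.
    + by apply/measurable_EFinP; exact: measurable_funTS.
    + apply/eqP; rewrite -measure_le0 -Xle0 le_measure ?inE//; first exact: mitv.
      by move=> w /=; rewrite !in_itv/=; exact: ltW.
    have -> : ('E_P[fun w => (X1 w / s%:R)%R] = (fine 'E_P[X1] / s%:R)%:E)%E.
      have -> : ((fine 'E_P[X1] / s%:R)%:E = (s%:R^-1)%:E * 'E_P[X1])%E.
        by rewrite mean_X1_fin -EFinM mulrC.
      rewrite mean_abs_X1 -ge0_integralZl//.
      rewrite unlock; apply: ae_eq_integral => //.
      - exact/measurable_EFinP.
      - exact: measurable_funeM.
      - apply: filterS ae_X1_gt0 => w w0 _ /=.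
        by rewrite gtr0_norm// -EFinM mulrC.
    move=> /eqP; rewrite mule_eq0 => /orP[/eqP//|].
    by rewrite eqe mulf_eq0 invr_eq0 gt_eqF ?mean_X1_gt0//= gt_eqF.
  - by move=> w /= /negP; rewrite -ltNge in_itv.
have aUL : {ae P, forall w, 0 <= U w * L w /\ 0 <= (1 - U w) * L w}.
  apply: filterS2 aU aL => w /andP[U0 U1] L0.
  by split; rewrite mulr_ge0// subr_ge0.
have aBS : {ae P, forall w, (forall k, 0 < Bw k w) /\ (forall k, 0 <= Sv (back_index k) w)}.
  by apply: filterS2 aB aS => w ? ?; split.
have aFBS : {ae P, forall w, (forall k, 0 <= Fw k w) /\
    ((forall k, 0 < Bw k w) /\ (forall k, 0 <= Sv (back_index k) w))}.
  by apply: filterS2 aF aBS => w ? ?; split.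
by apply: filterS2 aUL aFBS => w [? ?] [? [? ?]]; split.
Qed.

End stationary_facts.

(** * A bound of order [b] on the mean, for [b^Lr >= s] *)

Lemma succ_mul_le_sqr (s b : nat) : (b <= s)%N -> ((s * b).+1 <= s.+1 ^ 2)%N.
Proof.
move=> bs; have : (s * b <= s * s)%N by rewrite leq_mul2l bs orbT.
by rewrite expnS expn1 mulSn mulnS; lia.
Qed.

Lemma absorb_constants {R : realType} (b g e u z t : R) : 1 <= b -> 0 <= g -> 0 <= e ->
  b + (g + e) + u * b + z * b * t <= (1 + g + e + u + z * t) * b.
Proof.
move=> b1 g0 e0; rewrite -subr_ge0.
have -> : (1 + g + e + u + z * t) * b - (b + (g + e) + u * b + z * b * t) =
  (g + e) * (b - 1) by ring.
by rewrite mulr_ge0 ?subr_ge0// addr_ge0.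
Qed.

Section mean_bound.
Context {d : measure_display} {Omega : measurableType d} {R : realType}.
Variables (P : probability Omega R) (X1 V1 : Omega -> R).
Hypothesis mX1 : measurable_fun setT X1.
Hypothesis mV1 : measurable_fun setT V1.
Hypothesis X1_fin : ('E_P[X1] < +oo)%E.
Hypothesis X1_pos : P [set w | X1 w <= 0] = 0%E.
Hypothesis V1_ge0 : forall w, 0 <= V1 w.
Hypothesis V1_moment : forall q : R, 0 < q -> ('E_P[fun w => (V1 w `^ q)%R] < +oo)%E.
Hypothesis rho_lt1 : fine 'E_P[V1] / fine 'E_P[X1] < 1.

Lemma mean_tau_le (Lr : nat) : (0 < Lr)%N ->
  exists (C : R) (N : nat), 0 <= C /\
  forall (s b : nat), (N <= s)%N -> (0 < s)%N -> (0 < b <= s)%N -> (s <= b ^ Lr)%N ->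
  forall (L U : Omega -> R) (Fw Bw : nat -> Omega -> R) (Sv : int -> Omega -> R),
  stationary_system P X1 V1 s L U Fw Bw Sv ->
  (\int[P]_w `| tau (fun n => arr_time (L w) (U w) (fun k => Fw k w) (fun k => Bw k w) n)
     (fun n => Sv n w) s | <= (C * b%:R)%:E)%E.
Proof.
move=> Lr0.
have mom (q : nat) : exists2 M : R, 0 <= M & (\int[P]_w ((1 + V1 w) ^+ q)%:E <= M%:E)%E.
  apply: moment_1p => // q' q'0; by have := V1_moment q'0; rewrite unlock.
pose mu := fine 'E_P[X1]; have mu0 : 0 < mu by exact: mean_X1_gt0.
have muE : (\int[P]_w (`|X1 w|)%:E = mu%:E)%E.
  by rewrite -mean_abs_X1// /mu -mean_X1_fin.
pose EV := fine 'E_P[V1].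
have EVE : (\int[P]_w (V1 w)%:E = EV%:E)%E.
  rewrite /EV unlock fineK// ge0_fin_numE; last first.
    by apply: integral_ge0 => w _; rewrite lee_fin.
  have [M _ HM] := mom 1%N; apply: le_lt_trans (ltry M); apply: le_trans HM.
  apply: ge0_le_integral => //=.
  - by move=> w _; rewrite lee_fin.
  - exact/measurable_EFinP.
  - by apply/measurable_EFinP; apply: measurable_funX; exact: measurable_funD.
  - by move=> w _; rewrite lee_fin expr1 lerDr.
have EV0 : 0 <= EV.
  by rewrite -lee_fin -EVE; apply: integral_ge0 => w _; rewrite lee_fin.
have EVmu : EV < mu by move: rho_lt1; rewrite ltr_pdivrMr// mul1r.
(* [EV < v' < c1 < mu]: [c1] is the nominal interarrival time, slightly below the
   mean, and [v'] leaves room for a positive Chernoff exponent even when [EV = 0]. *)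
pose c1 := (EV + 2 * mu) / 3; pose v' := (2 * EV + mu) / 3.
have c10 : 0 < c1 by rewrite /c1; lra.
have v'0 : 0 < v' by rewrite /v'; lra.
have EVv' : EV <= v' by rewrite /v'; lra.
have v'c1 : v' < c1 by rewrite /v' /c1; lra.
have c1mu : c1 < mu by rewrite /c1; lra.
pose kap := v' / c1.
have kap0 : 0 < kap by rewrite divr_gt0.
have kap1 : kap < 1 by rewrite ltr_pdivrMr// mul1r.
(* The mean number of late customers will be at most [kap s] and the Chernoff threshold at least
   [lam s]; the margin [1 - lam] accommodates the [i0] youngest customers. *)
pose lam := (1 + kap) / 2.
have lam1 : lam < 1 by rewrite /lam; lra.
have kaplam : 0 < kap < lam by rewrite kap0 /lam; lra.
have [theta [alpha [theta0 /andP[alpha0 alpha1] a1 laplace]]] :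
    exists theta alpha : R, [/\ 0 < theta, 0 < alpha <= 1, expR (theta * c1) * alpha < 1 &
    (\int[P]_w (expR (- (theta * `|X1 w|)))%:E <= alpha%:E)%E].
  by apply: laplace_below_mean; rewrite ?ltW// muE lte_fin.
have [eta [a2 [eta0 a2_itv chernoff]]] := chernoff_exponent kaplam.
pose a := expR (theta * c1) * alpha.
have a_itv : 0 < a < 1 by rewrite mulr_gt0 ?expR_gt0.
have a0 : 0 < 1 - a by rewrite subr_gt0; case/andP: a_itv.
(* Then [b^q >= s^3]: two powers of [s] offset the [s^2] of [sum_lag_le], the third makes the late
   sum small. *)
pose q := (3 * Lr)%N; have q2 : (2 < q)%N by exact: leq_pmulr.
have [M1 M10 HM1] := mom q.+2.
have ci : 0 < c1^-1 by rewrite invr_gt0.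
have ci1 n : 0 <= (1 + c1^-1) ^+ n by rewrite exprn_ge0//; lra.
pose D1 := (1 + c1^-1) ^+ q.+2 * M1.
have D10 : 0 <= D1 by rewrite mulr_ge0.
have [Da Da0 HDa] := exprn_le_poly q.+1 a_itv.
(* [b^(2 Lr) >= s^2] will cancel the [s^2] in the series of the excess. *)
have [M2 M20 HM2] := mom (2 * Lr).+3.
pose D2 := (1 + c1^-1) ^+ 2 * M2.
have D20 : 0 <= D2 by rewrite mulr_ge0.
(* Chosen so that [i0], the integer part of [s / e], is at most [(1 - lam) s]. *)
pose e := (Num.truncn (1 - lam)^-1).+1.
have e_lam : e%:R^-1 <= 1 - lam.
  rewrite invf_ple ?posrE// ?subr_gt0//.
  by apply/ltW; exact: truncnS_gt.
(* Three contributions of [1/24] make each window fail with bound [1/8]. *)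
have e24 : 0 < (24^-1 : R) by rewrite invr_gt0.
(* The polynomial factor [e^2 (i0 + 1)^2] will dominate [h + 1 <= (s + 1)^2]. *)
have [N1 HN1] := poly_exprn_small (e%:R ^+ 2 / (1 - a)) 2 a_itv e24.
have [N2 HN2] := poly_exprn_small 1 2 a2_itv e24.
pose N3 := (Num.truncn (48 * D1)).+1.
(* In order: the cutoff [b] of the excess, its series (two terms), the first [T 1 = 4 h]
   interarrival times, and the stage costs. *)
exists (1 + 2 * D2 + EV / (1 - a) + 4 * (mu / alpha) +
  32 * (mu / alpha) * (1 + 2 * (2 * (D1 + Da)))), (e * N1.+1 + N2 + N3)%N.
have EVa : 0 <= EV / (1 - a) by rewrite divr_ge0// ltW.
have mua : 0 <= mu / alpha by rewrite divr_ge0// ltW.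
have DD : 0 <= D1 + Da by exact: addr_ge0.
split.
  apply: addr_ge0; last first.
    apply: mulr_ge0; first exact: mulr_ge0.
    by rewrite addr_ge0// mulr_ge0// mulr_ge0.
  have H1 : 0 <= 1 + 2 * D2 by rewrite addr_ge0// mulr_ge0.
  exact: (addr_ge0 (addr_ge0 H1 EVa) (mulr_ge0 (ler0n _ 4) mua)).
move=> s b Ns s0 /andP[b0 bs] sb L U Fw Bw Sv sys.
have s1 : 1 <= s%:R :> R by rewrite ler1n.
have sR : 0 < s%:R :> R by rewrite ltr0n.
have bR : 0 < b%:R :> R by rewrite ltr0n.
have [mB mS] := stationary_measurable sys.
pose v k := Sv (back_index k).
(* Interarrival times have the law of [X1 / s], so the Laplace parameter is scaled by [s]. *)
pose kappa := theta * s%:R; have kappa0 : 0 <= kappa by rewrite mulr_ge0 ?ltW.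
pose xi := mu / s%:R.
pose y i : R := c1 * i%:R / s%:R.
have nsi : `|s%:R^-1| = s%:R^-1 :> R by rewrite gtr0_norm ?invr_gt0.
have x_laplace i : (\int[P]_w (expR (- (kappa * `|Bw i w|)))%:E <= alpha%:E)%E.
  rewrite (stationary_arrival_law mX1 sys i (g := fun z => expR (- (kappa * `|z|)))).
  - apply: le_trans laplace; rewrite le_eqVlt; apply/orP; left; apply/eqP.
    apply: eq_integral => w _; rewrite /kappa normrM nsi.
    by congr (expR (- _))%:E; field; rewrite gt_eqF.
  - apply: measurableT_comp => //; apply: measurableT_comp => //.
    by apply: measurable_funM => //; exact: measurableT_comp.
  - by move=> z; exact: expR_ge0.
have x_mean i : (\int[P]_w (`|Bw i w|)%:E <= xi%:E)%E.
  rewrite (stationary_arrival_law mX1 sys i (g := fun z => `|z|))//.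
  have -> : (fun w => (`|X1 w / s%:R|)%:E) = (fun w => (s%:R^-1)%:E * (`|X1 w|)%:E)%E.
    apply/funext => w; rewrite normrM nsi.
    by rewrite -EFinM mulrC.
  rewrite ge0_integralZl//; first by rewrite muE -EFinM mulrC.
  by apply/measurable_EFinP; exact: measurableT_comp.
have v_law := stationary_service_law mV1 sys.
have y_lin i : expR (kappa * y i) * alpha ^+ i = a ^+ i.
  rewrite /a exprMn -expRM_natl; congr (expR _ * _).
  by rewrite /kappa /y; field; rewrite gt_eqF.
pose p i := fine (\int[P]_w ((y i < V1 w)%R%:R : R)%:E)%E.
have tail i := tail_moment mV1 V1_ge0 c10 s1 i HM1.
have pE i : (\int[P]_w ((y i < V1 w)%R%:R : R)%:E = (p i)%:E)%E.
  rewrite /p fineK// ge0_fin_numE; last first.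
    by apply: integral_ge0 => w _; rewrite lee_fin.
  exact: le_lt_trans (tail i) (ltry _).
have p_bound i : p i <= D1 * (s%:R / i.+1%:R) ^+ q.+2.
  by rewrite -lee_fin -pE; exact: tail.
have a_bound i : a ^+ i <= Da * (s%:R / i.+1%:R) ^+ q.+2.
  apply: le_trans (HDa i) _; rewrite ler_wpM2l// expr_div_n.
  by rewrite ler_peMl ?invr_ge0 ?exprn_ge0// exprn_ege1.
have pa_bound i : p i + a ^+ i <= (D1 + Da) * (s%:R / i.+1%:R) ^+ q.+2.
  by rewrite mulrDl lerD.
pose h := (s * b)%N; have h0 : (0 < h)%N by rewrite muln_gt0 s0.
pose i0 := (s %/ e)%N.
have eN : (e * N1.+1 <= s)%N by apply: leq_trans Ns; rewrite -addnA leq_addr.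
have N2s : (N2 <= s)%N by apply: leq_trans Ns; rewrite addnAC leq_addl.
have N3s : (N3 <= s)%N by apply: leq_trans Ns; rewrite leq_addl.
have i0N : (N1 < i0)%N by rewrite /i0 leq_divRL// mulnC.
have i00 : (0 < i0)%N by exact: leq_ltn_trans i0N.
have i0s : (i0 <= s)%N by exact: leq_div.
have i0h : (i0 <= h)%N by rewrite (leq_trans i0s)// leq_pmulr.
pose K : R := (s - i0)%:R.
have HK : s%:R * lam <= K.
  rewrite /K natrB//.
  suff : i0%:R <= s%:R * (1 - lam) by rewrite mulrBr mulr1 !lerBrDr addrC.
  apply: (@le_trans _ _ (s%:R / e%:R)); last by rewrite ler_wpM2l// ltW.
  by rewrite ler_pdivlMr// -natrM ler_nat leq_divM.
have hs : h.+1%:R <= s.+1%:R ^+ 2 :> R.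
  by rewrite -natrX ler_nat; exact: succ_mul_le_sqr.
have sq : (s ^ 3 <= b ^ q)%N by rewrite /q mulnC expnM leq_exp2r.
have sq2 : (s ^ 2 <= b ^ q)%N by apply: leq_trans sq; rewrite leq_pexp2l.
have q1 m : \sum_(h <= i < m) p i <= 24^-1.
  apply: le_trans (sum_lag_bound m p_bound D10 s1 h0) _.
  have -> : s%:R / h%:R = b%:R^-1 :> R.
    by rewrite /h natrM; field; rewrite !gt_eqF.
  have sb3 : s%:R ^+ 2 * b%:R^-1 ^+ q <= s%:R^-1 :> R.
    rewrite exprVn ler_pdivrMr ?exprn_gt0// ler_pdivlMl//.
    by rewrite -exprS -!natrX ler_nat.
  have -> : D1 * (2 * s%:R ^+ 2 * b%:R^-1 ^+ q) = 2 * D1 * (s%:R ^+ 2 * b%:R^-1 ^+ q) by ring.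
  have D12 : 0 <= 2 * D1 by rewrite mulr_ge0.
  apply: le_trans (ler_wpM2l D12 sb3) _.
  rewrite ler_pdivrMr//.
  rewrite ler_pdivlMl//; have -> : 24 * (2 * D1) = 48 * D1 by ring.
  by apply/ltW/(lt_le_trans (truncnS_gt _)); rewrite ler_nat.
have q2' : h.+1%:R * (a ^+ i0 / (1 - a)) <= 24^-1.
  apply: le_trans (HN1 i0 (ltnW i0N)).
  have -> : e%:R ^+ 2 / (1 - a) * i0.+1%:R ^+ 2 * a ^+ i0 =
    (e%:R * i0.+1%:R) ^+ 2 * (a ^+ i0 / (1 - a)) by rewrite exprMn; ring.
  apply: ler_wpM2r; first by rewrite divr_ge0 ?exprn_ge0 ?ltW//; case/andP: a_itv.
  apply: le_trans hs _; apply: lerXn2r; rewrite ?nnegrE//.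
  by rewrite -natrM ler_nat mulnC ltn_ceil.
pose Pi := s%:R / c1 * EV.
have HPi m : \sum_(i0 <= i < m) p i <= Pi.
  by apply: (sum_tail_le mV1 V1_ge0 c10 s1 m i00 _ pE); rewrite EVE.
have PiK : Pi <= s%:R * kap.
  have -> : Pi = s%:R * (EV / c1) by rewrite /Pi; ring.
  by rewrite ler_wpM2l// ler_wpM2r// ltW.
have q3 : h.+1%:R * expR ((expR eta - 1) * Pi - eta * K) <= 24^-1.
  apply: le_trans (HN2 s N2s); rewrite mul1r.
  by apply: ler_pM => //; exact: chernoff.
pose T := stage_index h.
have Th j : (T j + h <= T j.+1)%N by exact: stage_index_step.
have indep := stationary_indep sys.
have p_le i : (\int[P]_w ((y i < V1 w)%R%:R : R)%:E <= (p i)%:E)%E by rewrite pE.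
have win j : window_le P Bw v kappa alpha (T j) (T j.+1)
    (fun w => window_failure y kappa eta (fun l => `|Bw l w|) (fun l => v l w)
      K i0 h (T j) (T j.+1)) 8^-1.
  have -> : 8^-1 = 24^-1 + (24^-1 + 24^-1) :> R by field.
  by apply: (window_failure_le mB mS mV1 alpha0 v_law eta0 a_itv y_lin p_le (Th j) q1 q2' HPi q3).
have rho j m : \sum_(0 <= n < m) (p (T j.+1 + n - (T j + h))%N +
     a ^+ (T j.+1 + n - (T j + h))%N) <= 2 * (D1 + Da) * 8^-1 ^+ j.
  exact: (remote_lag_bound j m s0 b0 sq2 q2 DD pa_bound).
have xia : 0 <= xi / alpha by rewrite !divr_ge0 ?ltW.
have HS m : \sum_(0 <= k < m) ((T (2 * k).+3)%:R * (xi / alpha) *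
     (8^-1 ^+ k.+1 + \sum_(k <= j < (2 * k).+1) 2 * (D1 + Da) * 8^-1 ^+ j)) <=
     32 * h%:R * (xi / alpha) * (1 + 2 * (2 * (D1 + Da))).
  by apply: stage_sum_bound => //; rewrite mulr_ge0.
have HEV : (\int[P]_w (`|V1 w|)%:E <= EV%:E)%E.
  by rewrite -EVE; under eq_integral do rewrite ger0_norm//.
have exc i := excess_moment mV1 V1_ge0 c10 s1 i bR HM2.
have HG m : \sum_(0 <= n < m) ((1 + c1^-1) ^+ 2 * M2 * b%:R^-1 ^+ (2 * Lr) *
    (s%:R / n.+1%:R) ^+ 2 + a ^+ n * EV) <= 2 * D2 + EV / (1 - a).
  rewrite big_split/=; apply: lerD; last first.
    rewrite -mulr_suml mulrC ler_wpM2l//.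
    have /andP[/ltW a_0 a_1] := a_itv.
    have a_itv' : 0 <= a < 1 by rewrite a_0.
    by apply: le_trans (sum_geometric_le 0 m a_itv') _; rewrite expr0 div1r.
  apply: (@le_trans _ _ (\sum_(0 <= n < m) D2 * (n.+1%:R ^+ 2)^-1)); last first.
    by rewrite -mulr_sumr mulrC ler_wpM2r// sum_inv_sqr_le.
  apply: ler_sum => n _; rewrite -/D2 -mulrA ler_wpM2l// expr_div_n mulrA.
  rewrite ler_piMl ?invr_ge0 ?exprn_ge0// exprVn ler_pdivrMl ?exprn_gt0// mulr1.
  by rewrite -!natrX ler_nat mulnC expnM leq_exp2r.
have bR0 : 0 <= b%:R :> R by [].
have [mM M0 iM] := majorant_int mB mS mV1 indep alpha0 alpha1 kappa0 x_laplace x_mean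
  v_law eta0 a_itv y_lin p_le Th win rho HS bR0 HEV exc HG.
apply: (le_trans (le_trans _ iM)); last first.
  rewrite lee_fin.
  have -> : (T 1)%:R * (xi / alpha) = 4 * (mu / alpha) * b%:R.
    rewrite /T /stage_index /h !natrM /xi; field.
    by rewrite !gt_eqF.
  have -> : 32 * h%:R * (xi / alpha) = 32 * (mu / alpha) * b%:R.
    by rewrite /h natrM /xi; field; rewrite !gt_eqF.
  have b1 : 1 <= b%:R :> R by rewrite ler1n.
  by apply: absorb_constants => //; rewrite mulr_ge0.
apply: integral_le_ae_majorant => //.
have := stationary_ae mX1 X1_fin X1_pos V1_ge0 s0 sys.
apply: filterS => w [UL UL1 F0 B0 v0].
have Babs : (fun l => `|Bw l w|) = (fun l => Bw l w).
  by apply/funext => l; rewrite gtr0_norm.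
have BT : \sum_(0 <= i < T 1) `|Bw i w| = \sum_(0 <= i < T 1) Bw i w.
  by apply: eq_bigr => i _; rewrite gtr0_norm.
rewrite Babs BT.
set E := excess _ _ _ _ _.
have E0 : (0 <= E)%E by exact: excess_ge0.
have B0' l : 0 <= Bw l w by exact: ltW.
(* Where the excess is infinite the majorant is too; elsewhere its real value serves as [g]. *)
have [Efin|] := boolP (E \is a fin_num); last first.
  rewrite ge0_fin_numE// -leNgt leye_eq => /eqP ->.
  rewrite addye ?addye ?leey// -ltNye.
    by apply: lt_le_trans (ltNyr 0) _; apply: nneseries_ge0 => k _ _; exact: stage_cost_ge0.
rewrite -(fineK Efin).
have T0 : (0 < T 0)%N by rewrite /T /stage_index muln_gt0 h0.
have vg n : Sv (back_index n) w <= \sum_(0 <= i < n) Bw i w + fine E.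
  by rewrite -lee_fin EFinD fineK//; exact: le_excess.
exact: (@tau_le_stages R (L w) (U w) (fun k => Fw k w) (fun k => Bw k w)
  (fun n => Sv n w) s y kappa eta (fine E) T i0 h UL UL1 F0 B0 kappa0 eta0
  (fine_ge0 E0) i0h i0s T0 Th vg).
Qed.

End mean_bound.

(** * Choice of the root and conclusion *)

Unset Implicit Arguments.

Theorem theorem2 (d : measure_display) (Omega : measurableType d) (R : realType)
  (P : probability Omega R) (X1 V1 : Omega -> R)
  (L U : nat -> Omega -> R) (Fw Bw : nat -> nat -> Omega -> R)
  (Sv : nat -> int -> Omega -> R) :
  measurable_fun setT X1 -> measurable_fun setT V1 ->
  (* E X1 < oo, X1 > 0 a.s., non-lattice *)
  ('E_P[X1] < +oo)%E ->
  P [set w | X1 w <= 0] = 0%E ->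
  non_lattice P X1 ->
  (* V1 >= 0, all moments finite, continuous CDF *)
  (forall w, 0 <= V1 w) ->
  (forall q : R, 0 < q -> ('E_P[fun w => (V1 w `^ q)%R] < +oo)%E) ->
  continuous (CDF P V1) ->
  (* rho = E V1 / E X1 < 1 *)
  fine 'E_P[V1] / fine 'E_P[X1] < 1 ->
  (* the s-th time-stationary system, s >= 1 *)
  (forall s : nat, (0 < s)%N ->
     stationary_system P X1 V1 s (L s) (U s) (Fw s) (Bw s) (Sv s)) ->
  forall delta : R, 0 < delta ->
  forall eps : R, 0 < eps ->
  exists N : nat, forall s : nat, (N <= s)%N ->
    (\int[P]_w `| tau (fun n => arr_time (L s w) (U s w)
                                  (fun k => Fw s k w) (fun k => Bw s k w) n)
                     (fun n => Sv s n w) s |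
     <= (eps * (s%:R `^ delta))%:E)%E.
Proof.
move=> mX1 mV1 X1_fin X1_pos _ V1_ge0 V1_moment _ rho_lt1 sys delta delta0 eps eps0.
(* With [1 / Lr <= delta / 2] one has [b <= 2 s^(delta/2)]; the other half of the exponent is left
   to beat the constants. *)
pose Lr := (Num.truncn (2 / delta)).+1.
have Lr_delta : Lr%:R^-1 <= delta / 2.
  rewrite invf_ple ?posrE ?divr_gt0//.
  by apply/ltW/(le_lt_trans _ (truncnS_gt _)); rewrite invf_div.
have [C [N [C0 HC]]] := @mean_tau_le _ _ _ P X1 V1 mX1 mV1 X1_fin X1_pos V1_ge0
  V1_moment rho_lt1 Lr isT.
(* Beyond this threshold [s^(delta/2) >= 2 C / eps]. *)
pose z := (2 * C / eps) `^ (2 / delta).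
exists (maxn N (Num.truncn z).+1) => s; rewrite geq_max => /andP[Ns zs].
have s0 : (0 < s)%N by exact: leq_trans zs.
have [b [bs sb bL]] := least_root (isT : (0 < Lr)%N) s0.
apply: le_trans (HC s b Ns s0 bs sb _ _ _ _ _ (sys s s0)) _.
have s1 : 1 <= s%:R :> R by rewrite ler1n.
have sR : 0 < s%:R :> R by rewrite ltr0n.
pose t := s%:R `^ (delta / 2) : R.
have t1 : 1 <= t by rewrite -(powRr0 s%:R) ler_powR// ltW// divr_gt0.
have bt : b%:R <= 2 * t.
  have b0 : (0 < b)%N by case/andP: bs.
  rewrite -(prednK b0) -natr1.
  suff : b.-1%:R <= t by lra.
  apply: (@le_trans _ _ (s%:R `^ Lr%:R^-1)); last by rewrite ler_powR.
  have -> : b.-1%:R = (b.-1%:R ^+ Lr) `^ Lr%:R^-1 :> R.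
    rewrite -powR_mulrn// -powRrM mulfV ?pnatr_eq0//; exact/esym/powRr1.
  by rewrite ge0_ler_powR ?nnegrE ?invr_ge0 ?exprn_ge0// -natrX ler_nat ltnW.
have tt : s%:R `^ delta = t * t :> R.
  by rewrite /t -powRD ?(gt_eqF sR) ?implybT//; congr (_ `^ _); field.
have Ct : 2 * C / eps <= t.
  have c0 : 0 <= 2 * C / eps by rewrite divr_ge0 ?mulr_ge0// ltW.
  have -> : 2 * C / eps = z `^ (delta / 2).
    rewrite /z -powRrM -[delta / 2]invf_div mulfV ?powRr1// gt_eqF// divr_gt0//.
  rewrite ge0_ler_powR ?nnegrE ?powR_ge0// ?divr_ge0 ?(ltW delta0)//.
  by apply/ltW/(lt_le_trans (truncnS_gt _)); rewrite ler_nat.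
rewrite lee_fin tt.
have Ct' : 2 * C <= t * eps by rewrite -ler_pdivrMr.
apply: (@le_trans _ _ (C * (2 * t))); first by rewrite ler_wpM2l.
have -> : C * (2 * t) = 2 * C * t by ring.
by rewrite mulrA [eps * t]mulrC ler_wpM2r// (le_trans ler01).
Qed.
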